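(* Let $M$ be a $(2h+2k+2)$-dimensional manifold endowed with a metric contact pair $(\alpha_1,\alpha_2,\phi,g)$ of type $(h,k)$, with $h\geq 1$, and with decomposable $\phi$. If $g$ is flat, then $h\leq 1$ and $k\leq 1$.
   Context: All objects are smooth. The exterior derivative of a 1-form is normalized by $2\,d\alpha(X,Y)=X\alpha(Y)-Y\alpha(X)-\alpha([X,Y])$. Contact pair of type $(h,k)$ ($h,k\ge 0$ integers) on a $(2h+2k+2)$-dimensional manifold $M$: a pair of 1-forms $(\alpha_1,\alpha_2)$ such that $\alpha_1\wedge(d\alpha_1)^h\wedge\alpha_2\wedge(d\alpha_2)^k$ is a volume form, $(d\alpha_1)^{h+1}=0$ and $(d\alpha_2)^{k+1}=0$. The Reeb vector fields $Z_1,Z_2$ are the unique vector fields with $\alpha_i(Z_j)=\delta_{ij}$ and $i_{Z_j}d\alpha_i=0$ for all $i,j\in\{1,2\}$. The distribution $T\mathcal{F}_i=\ker\alpha_i\cap\ker d\alpha_i$ is integrable and defines the characteristic foliation $\mathcal{F}_i$ of $\alpha_i$; $TM=T\mathcal{F}_1\oplus T\mathcal{F}_2$. A contact pair structure $(\alpha_1,\alpha_2,\phi)$ consists of a contact pair and a $(1,1)$-tensor field $\phi$ with $\phi^2=-\mathrm{Id}+\alpha_1\otimes Z_1+\alpha_2\otimes Z_2$ and $\phi Z_1=\phi Z_2=0$. The tensor $\phi$ is decomposable if $\phi(T\mathcal{F}_i)\subset T\mathcal{F}_i$ for $i=1,2$. A Riemannian metric $g$ is associated if $g(X,\phi Y)=(d\alpha_1+d\alpha_2)(X,Y)$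 and $g(X,Z_i)=\alpha_i(X)$ for $i=1,2$ and all vector fields $X,Y$. A metric contact pair is a quadruple $(\alpha_1,\alpha_2,\phi,g)$ with $(\alpha_1,\alpha_2,\phi)$ a contact pair structure and $g$ an associated metric. Flat means that the Riemann curvature tensor vanishes identically. *)

(* Defs.v *)
From HB Require Import structures.
From mathcomp Require Import all_boot all_order all_algebra perm.
From mathcomp Require Import ring.
From mathcomp Require Import all_classical all_reals all_analysis.

Set Implicit Arguments.
Unset Strict Implicit.
Unset Printing Implicit Defensive.

Import Order.TTheory GRing.Theory Num.Theory.
Import numFieldNormedType.Exports.

Local Open Scope classical_set_scope.
Local Open Scope ring_scope.

Lemma differentiable_near (R : realType) (V W : normedModType R)
    (f g : V -> W) (x : V) :
  (\forall y \near x, f y = g y) -> differentiable f x -> differentiable g x.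
Proof.
move=> fg df; have fgx : f x = g x by exact: nbhs_singleton fg.
have dfc := diff_continuous df.
have : g \o shift x = cst (g x) + 'd f x +o_ 0 id.
  apply/eqaddoP => e e0; have := diff_locally df => /eqaddoP/(_ e e0).
  have : \forall h \near (0 : V), f (h + x) = g (h + x).
    by move: fg; rewrite (near_shift 0 x) /= => fg; apply: filterS fg => h;
       rewrite /= subr0.
  by apply: filterS2 => h; rewrite !fctE /= => <-; rewrite fgx.
move=> gE; apply/diff_locallyP; have dE := diff_unique dfc gE.
by rewrite dE; split.
Qed.

Section Smooth_on.
Context {R : realType} {n : nat}.
Implicit Types (U : set 'rV[R]_n) (f g : 'rV[R]_n -> R).

(* Meaningful for U open: outside of U, the directional derivative 'D_v f may
   take a junk value, but only its values on U matter. *)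
Fixpoint class_C (r : nat) U f : Prop :=
  match r with
  | 0 => forall x, U x -> {for x, continuous f}
  | r'.+1 => (forall x, U x -> differentiable f x) /\
             forall v : 'rV[R]_n, class_C r' U ('D_v f)
  end.

Definition smooth_on U f := forall r, class_C r U f.

Lemma class_C_ext r U f g : open U -> (forall x, U x -> f x = g x) ->
  class_C r U f -> class_C r U g.
Proof.
move=> oU.
have nearfg f' g' x : (forall y, U y -> f' y = g' y :> R) -> U x ->
    \forall y \near x, f' y = g' y.
  move=> e Ux; have : nbhs x U by exact: open_nbhs_nbhs.
  by apply: filterS => y; exact: e.
elim: r f g => [|r IH] f g fg /=.
  move=> Cf x Ux; rewrite /prop_for /continuous_at -fg//.
  apply: cvg_trans (Cf x Ux).
  exact: (@near_eq_cvg _ _ (nbhs x) _ _ _ (nearfg _ _ _ fg Ux)).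
move=> [df Cf]; split=> [x Ux|v].
  exact: (differentiable_near (nearfg _ _ _ fg Ux) (df x Ux)).
by apply: IH (Cf v) => x Ux; apply: near_eq_derive; exact: nearfg.
Qed.

Lemma class_CW r U f : class_C r.+1 U f -> class_C r U f.
Proof.
elim: r f => [|r IH] f [df Cf].
  by move=> x Ux; exact/differentiable_continuous/df.
by split=> // v; exact/IH.
Qed.

Lemma class_C_cst r U (c : R) : class_C r U (cst c).
Proof.
elim: r c => [|r IH] c /=; first by move=> x _; exact: cst_continuous.
split=> [x _|v]; first exact: differentiable_cst.
by rewrite (_ : 'D_v _ = cst 0) //; apply/funext => x; rewrite derive_cst.
Qed.

Lemma class_C_lin r U f g (a : R) : open U ->
  class_C r U f -> class_C r U g -> class_C r U (a *: f + g).
Proof.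
move=> oU; elim: r f g => [|r IH] f g /=.
  move=> Cf Cg x Ux; rewrite /prop_for /continuous_at.
  exact: (cvgD (cvgZl_tmp (k := a) (Cf x Ux)) (Cg x Ux)).
move=> [df Cf] [dg Cg]; split=> [x Ux|v].
  by apply: differentiableD; [apply: differentiableZ; exact: df|exact: dg].
apply: class_C_ext (IH _ _ (Cf v) (Cg v)) => // x Ux.
have dfx : derivable f x v by exact/diff_derivable/df.
rewrite deriveD; first by rewrite deriveZ.
- exact: derivableZ.
- exact/diff_derivable/dg.
Qed.

Lemma class_C_mul r U f g : open U ->
  class_C r U f -> class_C r U g -> class_C r U (f * g).
Proof.
move=> oU; elim: r f g => [|r IH] f g.
  by move=> Cf Cg x Ux; exact: (cvgM (Cf x Ux) (Cg x Ux)).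
move=> Cf1 Cg1; have [Cf' Cg'] := (class_CW Cf1, class_CW Cg1).
case: Cf1 Cg1 => [df Cf] [dg Cg]; split=> [x Ux|v].
  by apply: differentiableM; [exact: df|exact: dg].
have C1 := IH _ _ Cf' (Cg v); have C2 := IH _ _ Cg' (Cf v).
apply: class_C_ext (class_C_lin 1 oU C1 C2) => // x Ux.
rewrite deriveM ?scale1r//; apply/diff_derivable; [exact: df|exact: dg].
Qed.

End Smooth_on.

Record chart (R : realType) (n : nat) (T : topologicalType) := Chart {
  chart_dom : set T;
  chart_map : T -> 'rV[R]_n;
  chart_inv : 'rV[R]_n -> T;
  chart_dom_open : open chart_dom;
  chart_img_open : open (chart_map @` chart_dom);
  chart_mapK : forall x, chart_dom x -> chart_inv (chart_map x) = x;
  chart_map_continuous :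
    forall x, chart_dom x -> {for x, continuous chart_map};
  chart_inv_continuous :
    forall y, (chart_map @` chart_dom) y -> {for y, continuous chart_inv}
}.

Definition chart_img (R : realType) (n : nat) (T : topologicalType)
  (c : chart R n T) : set 'rV[R]_n := chart_map c @` chart_dom c.

Definition smooth_transition (R : realType) (n : nat) (T : topologicalType)
    (c d : chart R n T) :=
  forall j : 'I_n,
    smooth_on (chart_map c @` (chart_dom c `&` chart_dom d))
      (fun y => chart_map d (chart_inv c y) ord0 j).

Record manifold (R : realType) (n : nat) := Manifold {
  mpoints :> topologicalType;
  atlas : set (chart R n mpoints);
  manifold_nonempty : [set: mpoints] !=set0;
  manifold_hausdorff : hausdorff_space mpoints;
  manifold_second_countable : @second_countable mpoints;
  atlas_cover : forall x : mpoints, exists2 c, atlas c & chart_dom c x;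
  atlas_compat : forall c d, atlas c -> atlas d -> smooth_transition c d
}.

Section Smooth_functions.
Context {R : realType} {n : nat} (M : manifold R n).

Definition is_smooth (f : M -> R) :=
  forall c : chart R n M, atlas c ->
    smooth_on (chart_img c) (f \o chart_inv c).

Definition smooth_pred : {pred M -> R} := fun f => `[< is_smooth f >].

Record smooth :=
  Smooth { smooth_fun :> M -> R; smooth_funP : smooth_fun \in smooth_pred }.

HB.instance Definition _ := [isSub for smooth_fun].
HB.instance Definition _ := [Choice of smooth by <:].

Lemma open_chart_img (c : chart R n M) : open (chart_img c).
Proof. exact: chart_img_open. Qed.
Arguments open_chart_img : clear implicits.

Lemma smooth_linear_closed : linear_closed smooth_pred.
Proof.
move=> a f g /asboolP sf /asboolP sg; apply/asboolP => c Ac r.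
exact: (class_C_lin a (open_chart_img c) (sf c Ac r) (sg c Ac r)).
Qed.

Lemma smooth_subring_closed : subring_closed smooth_pred.
Proof.
split=> [|f g sf sg|f g /asboolP sf /asboolP sg].
- by apply/asboolP => c Ac r; exact: (class_C_cst r _ 1).
- by rewrite addrC -scaleN1r; exact: smooth_linear_closed.
- apply/asboolP => c Ac r.
  exact: (class_C_mul (open_chart_img c) (sf c Ac r) (sg c Ac r)).
Qed.

HB.instance Definition _ :=
  GRing.isSubringClosed.Build _ smooth_pred smooth_subring_closed.
HB.instance Definition _ :=
  GRing.SubChoice_isSubComPzRing.Build (M -> R) smooth_pred smooth
    smooth_subring_closed.

Lemma smooth_submod_closed : submod_closed smooth_pred.
Proof. by split; [exact: rpred0|exact: smooth_linear_closed]. Qed.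

HB.instance Definition _ :=
  GRing.SubZmodule_isSubLmodule.Build R (M -> R) smooth_pred smooth
    (GRing.submod_closed_semi smooth_submod_closed).

Lemma smooth_oner_neq0 : 1 != 0 :> smooth.
Proof.
have [x _] := manifold_nonempty M; apply/eqP => /(congr1 (fun f : smooth => f x)).
by move=> /eqP; rewrite /= oner_eq0.
Qed.

HB.instance Definition _ :=
  GRing.PzSemiRing_isNonZero.Build smooth smooth_oner_neq0.

Lemma smooth_scalerAl (a : R) (f g : smooth) : a *: (f * g) = (a *: f) * g.
Proof. by apply/val_inj/funext => x; exact: mulrA. Qed.

HB.instance Definition _ :=
  GRing.Lmodule_isLalgebra.Build R smooth smooth_scalerAl.
HB.instance Definition _ := GRing.Lalgebra_isComAlgebra.Build R smooth.

End Smooth_functions.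

(* The vector fields on a (Hausdorff) manifold are the derivations of its
   R-algebra of smooth functions; they form a module over the smooth functions.
   In derivation and below, C^o is C seen as a module over itself, while a *: f
   with a : R and f : C is the scaling of the R-algebra C. *)

Section Vector_fields.
Context {R : realType} {n : nat} (M : manifold R n).
Local Notation C := (smooth M).

Definition derivation (X : C -> C^o) :=
  (forall (a : R) (f g : C), X (a *: f + g) = a *: (X f : C) + X g) /\
  (forall f g : C, X (f * g) = X f * g + f * X g).

Definition derivation_pred : {pred C -> C^o} := fun X => `[< derivation X >].

Record vfield := VField {
  vfield_fun :> C -> C^o;
  vfield_funP : vfield_fun \in derivation_pred
}.

HB.instance Definition _ := [isSub for vfield_fun].
HB.instance Definition _ := [Choice of vfield by <:].

Lemma derivation_submod_closed : submod_closed derivation_pred.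
Proof.
split=> [|h X Y /asboolP[Xl XM] /asboolP[Yl YM]]; apply/asboolP.
  have E f : (0 : C -> C^o) f = 0 :> C by [].
  by split=> [a f g|f g]; rewrite !E ?scaler0 ?mul0r ?mulr0 addr0.
have E f : (h *: X + Y) f = h * (X f : C) + (Y f : C) :> C by [].
split=> [a f g|f g]; rewrite !E.
  rewrite Xl Yl mulrDr scalerDr addrACA; congr (_ + _ + _).
  by rewrite -[LHS]scalerAr.
rewrite XM YM; move: (X f : C) (X g : C) (Y f : C) (Y g : C) => Xf Xg Yf Yg.
by ring.
Qed.

HB.instance Definition _ :=
  GRing.SubChoice_isSubLmodule.Build C (C -> C^o) derivation_pred vfield
    (GRing.submod_closed_semi derivation_submod_closed).

Lemma bracket_subproof (X Y : vfield) :
  (fun f : C => X (Y f) - Y (X f)) \in derivation_pred.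
Proof.
have [/asboolP[Xl XM] /asboolP[Yl YM]] := (vfield_funP X, vfield_funP Y).
have XD f g : X (f + g) = (X f : C) + X g.
  by have := Xl 1 f g; rewrite !scale1r.
have YD f g : Y (f + g) = (Y f : C) + Y g.
  by have := Yl 1 f g; rewrite !scale1r.
apply/asboolP; split=> [a f g|f g].
  by rewrite Yl Xl Xl Yl scalerBr opprD addrACA.
rewrite XM YM XD YD !XM !YM.
move: (X f : C) (X g : C) (Y f : C) (Y g : C) => Xf Xg Yf Yg.
move: (X Yf : C) (X Yg : C) (Y Xf : C) (Y Xg : C) => XYf XYg YXf YXg.
by ring.
Qed.

Definition bracket (X Y : vfield) : vfield := VField (bracket_subproof X Y).

(* The tangent vector X_x is zero. *)
Definition vanishes_at (X : vfield) (x : M) := forall f : C, (X f : C) x = 0.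

End Vector_fields.

(* On a Hausdorff manifold, the tensor fields are the maps on vector fields
   which are multilinear over the smooth functions. *)

Definition one_form (R : realType) (n : nat) (M : manifold R n) :=
  {linear vfield M -> (smooth M)^o}.

Definition tensor11 (R : realType) (n : nat) (M : manifold R n) :=
  {linear vfield M -> vfield M}.

Section Forms.
Context {R : realType} {n : nat} {M : manifold R n}.
Local Notation C := (smooth M).
Local Notation VF := (vfield M).

Definition form (p : nat) := ('I_p -> VF) -> C.

Definition ext_d (a : one_form M) (X Y : VF) : C :=
  2^-1 *: (X (a Y) - Y (a X) - a (bracket X Y) : C).

Definition form_of1 (a : one_form M) : form 1 := fun v => a (v ord0).

Definition form_of2 (w : VF -> VF -> C) : form 2 :=
  fun v => w (v ord0) (v ord_max).

(* The factor 1/(p+q)! goes with the factor 1/2 in ext_d: with both, d is an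
   antiderivation for the wedge product. *)
Definition wedge (p q : nat) (w : form p) (z : form q) : form (p + q) :=
  fun v => ((p + q)`!%:R^-1 : R) *:
    \sum_(s : 'S_(p + q))
      (-1) ^+ s * (w (fun i => v (s (lshift q i))) *
                   z (fun j => v (s (rshift p j)))).

Fixpoint wedge_exp (p : nat) (w : form p) (m : nat) : form (m * p) :=
  match m with
  | 0 => fun=> 1
  | m'.+1 => wedge w (wedge_exp w (m := m'))
  end.

(* Tangent vectors extend to vector fields, so this says that w has top degree
   and vanishes at no point. *)
Definition volume_form (p : nat) (w : form p) :=
  p = n /\ forall x : M, exists v : 'I_p -> VF, w v x != 0.

(* X_x belongs to ker a_x, and to ker (d a)_x, i.e. to (T F)_x where F is the
   characteristic foliation of a. *)
Definition in_char_foliation (a : one_form M) (x : M) (X : VF) :=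
  (a X : C) x = 0 /\ forall Y : VF, ext_d a X Y x = 0.

End Forms.
Arguments wedge_exp {R n M p} w m _.

Section Metrics.
Context {R : realType} {n : nat} {M : manifold R n}.
Local Notation C := (smooth M).
Local Notation VF := (vfield M).

Record riemannian_metric := RiemannianMetric {
  metric_fun :> VF -> VF -> C;
  metric_sym : forall X Y, metric_fun X Y = metric_fun Y X;
  metric_linear : forall (f : C) X Y Z,
    metric_fun (f *: X + Y) Z = f * metric_fun X Z + metric_fun Y Z;
  metric_pos : forall X x, ~ vanishes_at X x -> 0 < metric_fun X X x
}.

Record affine_connection (nabla : VF -> VF -> VF) : Prop := {
  connection_tensorial : forall (f : C) X Y Z,
    nabla (f *: X + Y) Z = f *: nabla X Z + nabla Y Z;
  connection_additive : forall X Y Z,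
    nabla X (Y + Z) = nabla X Y + nabla X Z;
  connection_leibniz : forall (f : C) X Y,
    nabla X (f *: Y) = (X f : C) *: Y + f *: nabla X Y
}.

Record levi_civita (g : riemannian_metric) (nabla : VF -> VF -> VF) : Prop := {
  levi_civita_connection : affine_connection nabla;
  levi_civita_torsion_free : forall X Y,
    nabla X Y - nabla Y X = bracket X Y;
  levi_civita_metric : forall X Y Z : VF,
    X (g Y Z) = g (nabla X Y) Z + g Y (nabla X Z)
}.

Definition curvature (nabla : VF -> VF -> VF) (X Y Z : VF) : VF :=
  nabla X (nabla Y Z) - nabla Y (nabla X Z) - nabla (bracket X Y) Z.

(* Every metric has exactly one Levi-Civita connection, so the existential
   only names it. *)
Definition flat (g : riemannian_metric) :=
  exists2 nabla, levi_civita g nabla & forall X Y Z, curvature nabla X Y Z = 0.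

End Metrics.
Arguments riemannian_metric {R n} M.

Section Contact_pairs.
Context {R : realType} {n : nat} {M : manifold R n}.
Local Notation C := (smooth M).
Local Notation VF := (vfield M).
Implicit Types (phi : tensor11 M) (g : riemannian_metric M) (X Y : VF).

Definition contact_pair (h k : nat) (a1 a2 : one_form M) :=
  [/\ volume_form
        (wedge (wedge (wedge (form_of1 a1) (wedge_exp (form_of2 (ext_d a1)) h))
                      (form_of1 a2))
               (wedge_exp (form_of2 (ext_d a2)) k)),
      forall v, wedge_exp (form_of2 (ext_d a1)) h.+1 v = 0 &
      forall v, wedge_exp (form_of2 (ext_d a2)) k.+1 v = 0].

Definition reeb_fields (a1 a2 : one_form M) (Z1 Z2 : VF) :=
  [/\ a1 Z1 = 1 /\ a1 Z2 = 0, a2 Z1 = 0 /\ a2 Z2 = 1,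
      forall X, ext_d a1 Z1 X = 0 /\ ext_d a1 Z2 X = 0 &
      forall X, ext_d a2 Z1 X = 0 /\ ext_d a2 Z2 X = 0].

Definition contact_pair_structure (h k : nat) (a1 a2 : one_form M) (Z1 Z2 : VF) phi :=
  [/\ contact_pair h k a1 a2, reeb_fields a1 a2 Z1 Z2,
      forall X, phi (phi X) = - X + (a1 X : C) *: Z1 + (a2 X : C) *: Z2,
      phi Z1 = 0 & phi Z2 = 0].

Definition associated_metric (a1 a2 : one_form M) (Z1 Z2 : VF) phi g :=
  (forall X Y, g X (phi Y) = ext_d a1 X Y + ext_d a2 X Y) /\
  (forall X, g X Z1 = a1 X /\ g X Z2 = a2 X).

(* A contact pair has exactly one pair of Reeb vector fields, so the existential
   only names it. *)
Definition metric_contact_pair (h k : nat) (a1 a2 : one_form M) phi g :=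
  exists Z1 Z2, contact_pair_structure h k a1 a2 Z1 Z2 phi /\
                associated_metric a1 a2 Z1 Z2 phi g.

Definition decomposable (a1 a2 : one_form M) phi :=
  forall (x : M) X,
    (in_char_foliation a1 x X -> in_char_foliation a1 x (phi X)) /\
    (in_char_foliation a2 x X -> in_char_foliation a2 x (phi X)).

End Contact_pairs.

(* Main.v *)
(** Let A_i X = nabla_X Z_i.  The 2-form d alpha_1 + d alpha_2 is invariant
    under the Reeb flows, so the Lie derivative of g along Z_i anticommutes with
    phi; as phi preserves both characteristic foliations, the adjoint of A_i is
    phi A_i phi and phi is parallel along Z_i.  Flatness gives
    nabla_(Z_j) A_i = - A_i A_j, and taking adjoints A_i A_j = - A_j A_i, whence
    A_i^2 = 0; a symmetric operator of square zero then shows that A_i vanishes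
    on T F_i.  Thus A = A_1 + A_2 satisfies phi A + A phi = 2 on the contact
    distribution, which splits into E = {A = - 2 phi} and phi E = ker A.  The
    Codazzi equation for A makes E totally geodesic and forces
    nabla_X (phi Y) = phi (nabla_X Y) + Reeb terms on E, so R(X, Y) phi W is
    phi R(X, Y) W plus Gauss terms of A_1 and A_2, which have orthogonal images.
    Hence all 2 x 2 minors of each A_i vanish: A_i has rank at most one, and
    d alpha_i rank at most two.

    Pointwise, (d alpha_i)^(m+1) = 0 bounds the rank of d alpha_i by 2m, by a
    symplectic Gram-Schmidt argument, and the volume condition bounds the
    dimension by 2 + rank d alpha_1 + rank d alpha_2.  Equality there gives the
    splitting TM = T F_1 + T F_2 used above, and with the rank bound two it gives
    h, k <= 1. *)

From HB Require Import structures.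
Require Import Defs.
From mathcomp Require Import all_boot all_order all_algebra.
From mathcomp Require Import perm ring zify lra.
From mathcomp Require Import all_classical all_reals all_analysis.

Set Implicit Arguments.
Unset Strict Implicit.
Unset Printing Implicit Defensive.

Import Order.TTheory GRing.Theory Num.Theory.

(** * Tensor calculus of a flat metric contact pair *)

Section Linear_combination.
Local Open Scope ring_scope.
Context {C : comNzRingType}.
Implicit Types a b c d : C.

(** Lets [ring] derive an equation as a linear combination of known ones, assembled with [lincombD]
    and [lincombN]. *)
Lemma eq_of_lincomb a b c d : a = b -> c - d = a - b -> c = d.
Proof. by move=> ->; rewrite subrr => /subr0_eq. Qed.

Lemma lincombD a b c d : a = b -> c = d -> a + c = b + d.
Proof. by move=> -> ->. Qed.

Lemma lincombN a b : a = b -> - a = - b.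
Proof. by move=> ->. Qed.

End Linear_combination.

Section Flat_contact_pair.
Local Open Scope ring_scope.
(** [C] models the smooth functions and [V] the vector fields; 2 is only cancellable in [C], so
    factors of 2 are kept. *)
Context (C : comNzRingType) (V : lmodType C).
Context (g : V -> V -> C) (der : V -> C -> C) (nab : V -> V -> V).
Context (Z : bool -> V) (phi : {linear V -> V}).
Implicit Types (X Y U W : V) (a b : bool).

Hypothesis two_inj : forall f : C, f + f = 0 -> f = 0.
Hypothesis derD : forall X f h, der X (f + h) = der X f + der X h.
Hypothesis derM : forall X f h, der X (f * h) = der X f * h + f * der X h.

Hypothesis gC : forall X Y, g X Y = g Y X.
Hypothesis gL : forall f X Y W, g (f *: X + Y) W = f * g X W + g Y W.
Hypothesis g_definite : forall X, g X X = 0 -> X = 0.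

Hypothesis nabL : forall f X Y W,
  nab (f *: X + Y) W = f *: nab X W + nab Y W.
Hypothesis nabD : forall X Y W, nab X (Y + W) = nab X Y + nab X W.
Hypothesis nabZ : forall f X Y, nab X (f *: Y) = der X f *: Y + f *: nab X Y.
Hypothesis nab_metric : forall X Y W,
  der X (g Y W) = g (nab X Y) W + g Y (nab X W).

Let br X Y := nab X Y - nab Y X.

Hypothesis nab_flat : forall X Y W,
  nab X (nab Y W) - nab Y (nab X W) - nab (br X Y) W = 0.

Definition shape b X := nab X (Z b).
Local Notation A := shape.

(* Twice the exterior derivative of the form dual to [Z b]. *)
Definition dform b X Y := g (A b X) Y - g X (A b Y).
Local Notation d := dform.

Hypothesis gZZ : forall a b, g (Z a) (Z b) = (a == b)%:R.
Hypothesis dZ : forall a b X, d b (Z a) X = 0.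
Hypothesis gphi_d : forall X Y, g X (phi Y) *+ 2 = d true X Y + d false X Y.
Hypothesis phi2 : forall X,
  phi (phi X) = - X + g X (Z true) *: Z true + g X (Z false) *: Z false.
Hypothesis phiZ : forall b, phi (Z b) = 0.
(** [d_phi] and [d_split] carry the splitting of the tangent bundle and the decomposability of
    [phi]. *)
Hypothesis d_phi : forall b X Y, d b (phi X) (phi Y) = d b X Y.
Hypothesis d_split : forall b X U,
  (forall W, g U W = d (~~ b) (phi X) W) -> forall Y, d b U Y = 0.

Lemma gDl X Y W : g (X + Y) W = g X W + g Y W.
Proof. by have := gL 1 X Y W; rewrite scale1r mul1r. Qed.

Lemma g0l W : g 0 W = 0.
Proof. by apply: (addrI (g 0 W)); rewrite -gDl !addr0. Qed.

Lemma gZl f X W : g (f *: X) W = f * g X W.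
Proof. by have := gL f X 0 W; rewrite g0l !addr0. Qed.

Lemma gNl X W : g (- X) W = - g X W.
Proof. by rewrite -scaleN1r gZl mulN1r. Qed.

Lemma gDr W X Y : g W (X + Y) = g W X + g W Y.
Proof. by rewrite !(gC W) gDl. Qed.

Lemma g0r W : g W 0 = 0.
Proof. by rewrite gC g0l. Qed.

Lemma gZr f W X : g W (f *: X) = f * g W X.
Proof. by rewrite !(gC W) gZl. Qed.

Lemma gNr W X : g W (- X) = - g W X.
Proof. by rewrite !(gC W) gNl. Qed.

Let gE := (gDl, gDr, gNl, gNr, gZl, gZr, g0l, g0r).

Lemma g_inj X Y : (forall W, g X W = g Y W) -> X = Y.
Proof.
by move=> h; apply/subr0_eq/g_definite; rewrite gDl gNl h subrr.
Qed.

Lemma two_injV X : X + X = 0 -> X = 0.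
Proof. by move=> h; apply/g_definite/two_inj; rewrite -gDl h g0l. Qed.

Lemma eq_two (f h : C) : f + f = h + h -> f = h.
Proof.
by move=> e; apply/subr0_eq/two_inj; rewrite addrACA e -opprD subrr.
Qed.

Lemma der0 X : der X 0 = 0.
Proof. by apply: (addrI (der X 0)); rewrite -derD !addr0. Qed.

Lemma der1 X : der X 1 = 0.
Proof.
by apply: (addrI (der X 1)); rewrite addr0 -{3}[1]mulr1 derM mulr1 mul1r.
Qed.

Lemma derN X f : der X (- f) = - der X f.
Proof. by apply/eqP; rewrite -addr_eq0 -derD addNr der0. Qed.

Lemma der_bool X (t : bool) : der X t%:R = 0.
Proof. by case: t; rewrite ?der1 ?der0. Qed.

Lemma nab0 X : nab X 0 = 0.
Proof. by apply: (addrI (nab X 0)); rewrite -nabD !addr0. Qed.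

Lemma nabN X Y : nab X (- Y) = - nab X Y.
Proof. by apply/eqP; rewrite -addr_eq0 -nabD addNr nab0. Qed.

Lemma shape_linear b : linear (A b).
Proof. by move=> f X Y; exact: nabL. Qed.

HB.instance Definition _ b := GRing.isLinear.Build C V V *:%R (A b) (shape_linear b).

Let phiD X Y : phi (X + Y) = phi X + phi Y. Proof. exact: linearD. Qed.
Let phiN X : phi (- X) = - phi X. Proof. exact: linearN. Qed.
Let phiB X Y : phi (X - Y) = phi X - phi Y. Proof. exact: linearB. Qed.
Let phi0 : phi 0 = 0. Proof. exact: linear0. Qed.
Let AD b X Y : A b (X + Y) = A b X + A b Y. Proof. exact: linearD. Qed.
Let AN b X : A b (- X) = - A b X. Proof. exact: linearN. Qed.
Let AB b X Y : A b (X - Y) = A b X - A b Y. Proof. exact: linearB. Qed.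
Let A0 b : A b 0 = 0. Proof. exact: linear0. Qed.

(** * Shape operators and Reeb fields *)

Lemma dC b X Y : d b X Y = - d b Y X.
Proof. by rewrite /d !(gC X) opprB !(gC (A b X)). Qed.

Lemma gphi X Y : g X (phi Y) = - g (phi X) Y.
Proof.
apply: eq_two; rewrite -opprD -!mulr2n (gC (phi X)) !gphi_d.
by rewrite !(dC _ X) -opprD.
Qed.

Lemma gphiZ X b : g (phi X) (Z b) = 0.
Proof. by rewrite -[LHS]opprK -gphi phiZ g0r oppr0. Qed.

Lemma gAZ_same b X : g (A b X) (Z b) = 0.
Proof.
apply: two_inj; have := nab_metric X (Z b) (Z b).
by rewrite gZZ eqxx der1 (gC (Z b)) => <-.
Qed.

Lemma gAZ_skew a b X : g (A a X) (Z b) = - g (A b X) (Z a).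
Proof.
have := nab_metric X (Z a) (Z b); rewrite gZZ der_bool (gC (Z a)) => h.
by apply: (eq_of_lincomb (esym h)); rewrite -/(A a X) -/(A b X); ring.
Qed.

Lemma dZ_sym a b X : g (A b (Z a)) X = g (Z a) (A b X).
Proof. by apply/subr0_eq; rewrite -/(d b (Z a) X) dZ. Qed.

(* This is [d (d alpha_b) = 0]: contracted with a Reeb field it says that the
   Lie derivative of [d alpha_b] vanishes.  Flatness gives it directly. *)
Lemma lie_d a b X Y : der (Z a) (d b X Y) = d b (br (Z a) X) Y + d b X (br (Z a) Y).
Proof.
have f1 X' : nab (Z a) (A b X') = nab X' (A b (Z a)) + A b (br (Z a) X').
  by have /subr0_eq/(canRL (subrK _)) := nab_flat (Z a) X' (Z b); rewrite addrC.
have f2 X' Y' : g (nab X' (A b (Z a))) Y' + g (A b (Z a)) (nab X' Y') =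
    g (A a X') (A b Y') + g (Z a) (nab X' (A b Y')).
  by rewrite -!nab_metric dZ_sym.
(* By flatness the left side is [g (Z a) (A b (br X Y))]. *)
have f3 : g (Z a) (nab X (A b Y)) - g (Z a) (nab Y (A b X)) =
          g (A b (Z a)) (nab X Y) - g (A b (Z a)) (nab Y X).
  have /subr0_eq e := nab_flat X Y (Z b).
  by rewrite -!gNr -!gDr e -/(A b (br X Y)) -dZ_sym.
rewrite {1}/d derD derN !nab_metric !f1 /d /br !(AB, gE) /=.
by apply: (eq_of_lincomb (lincombD f3 (lincombD (f2 X Y) (lincombN (f2 Y X)))));
   rewrite (gC X (nab Y _)) (gC (A a Y) (A b X)); ring.
Qed.

(** The bracket is killed by both forms [d], hence by [phi], and is orthogonal to both Reeb fields;
    [phi2] then forces it to vanish. *)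
Lemma bracket_reeb a b : nab (Z a) (Z b) = nab (Z b) (Z a).
Proof.
have [<-//|ab] := eqVneq a b.
apply/subr0_eq; rewrite -/(br (Z a) (Z b)).
have dW c Y : d c (br (Z a) (Z b)) Y = 0.
  have := lie_d a c (Z b) Y; rewrite !dZ der0 addr0 => <-; exact: erefl.
have W0 : phi (br (Z a) (Z b)) = 0.
  apply: g_inj => Y; rewrite g0l; apply/eqP; rewrite -oppr_eq0 -gphi; apply/eqP.
  by apply: two_inj; rewrite -mulr2n gphi_d !dW addr0.
have Wa : g (br (Z a) (Z b)) (Z a) = 0.
  rewrite gDl gNl -/(A b _) -/(A a _) gAZ_same subr0 gAZ_skew gC -dZ_sym.
  by rewrite gAZ_same oppr0.
have Wb : g (br (Z a) (Z b)) (Z b) = 0.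
  rewrite gDl gNl -/(A b _) -/(A a _) gAZ_same sub0r gAZ_skew gC -dZ_sym.
  by rewrite gAZ_same !oppr0.
have := phi2 (br (Z a) (Z b)); rewrite W0 phi0.
have -> : g (br (Z a) (Z b)) (Z true) = 0 by case: (a) (b) ab Wa Wb => [] [].
have -> : g (br (Z a) (Z b)) (Z false) = 0 by case: (a) (b) ab Wa Wb => [] [].
by rewrite !scale0r !addr0 => /eqP; rewrite eq_sym oppr_eq0 => /eqP.
Qed.

(** [bracket_reeb] makes [A b (Z a)] symmetric in [a] and [b], while [dZ_sym] and [gAZ_skew] make it
    skew. *)
Lemma shape_reeb a b : A b (Z a) = 0.
Proof.
apply: g_inj => X; rewrite g0l; apply: two_inj.
rewrite {1}dZ_sym gC gAZ_skew gC -dZ_sym /shape bracket_reeb.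
by rewrite addNr.
Qed.

Lemma gAZ a b X : g (A b X) (Z a) = 0.
Proof. by rewrite gC -dZ_sym shape_reeb g0l. Qed.

Lemma shape_phi2 b X : A b (phi (phi X)) = - A b X.
Proof. by rewrite phi2 !AD AN /= !linearZ /= !shape_reeb !scaler0 !addr0. Qed.

Lemma phi2_shape b X : phi (phi (A b X)) = - A b X.
Proof. by rewrite phi2 !gAZ !scale0r !addr0. Qed.

(** * Reeb invariance and adjoints of the shape operators *)

Lemma gphi2 X Y : g (phi X) (phi Y) =
  g X Y - g X (Z true) * g Y (Z true) - g X (Z false) * g Y (Z false).
Proof. by rewrite gphi phi2 !gE !(gC (Z _)); ring. Qed.

Let lie_phi_form a X Y :
  g X (nab (Z a) (phi Y) - phi (nab (Z a) Y)) =
  g (phi X) (A a Y) - g (A a X) (phi Y).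
Proof.
have h X' Y' : g X' (phi Y') + g X' (phi Y') = d true X' Y' + d false X' Y'.
  by rewrite -mulr2n gphi_d.
have e : der (Z a) (g X (phi Y)) =
    g (br (Z a) X) (phi Y) + g X (phi (br (Z a) Y)).
  apply: eq_two; rewrite addrACA !h -derD h derD !lie_d; ring.
rewrite nab_metric /br !(phiB, gE) -!/(A _ _) in e *.
by apply: (eq_of_lincomb e); rewrite !gphi; ring.
Qed.

(** Since [phi o phi] is parallel along [Z a], the derivative [Q] of [phi] anticommutes with [phi];
    compare [lie_phi_form] at [(X, phi Y)] and [(phi X, Y)]. *)
Let gAsym_phi a X Y : g (A a (phi X)) (phi Y) + g (phi X) (A a (phi Y)) =
  - (g (A a X) Y + g X (A a Y)).
Proof.
pose Q W := nab (Z a) (phi W) - phi (nab (Z a) W).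
have QphiE : Q (phi Y) = - phi (Q Y).
  have e b : der (Z a) (g Y (Z b)) = g (nab (Z a) Y) (Z b).
    by rewrite nab_metric -/(A b _) shape_reeb g0r addr0.
  rewrite /Q phiB (phi2 Y) !nabD nabN !nabZ !e -!/(A _ _) !shape_reeb.
  by rewrite (phi2 (nab _ _)) !scaler0; apply: g_inj => W; rewrite !gE; ring.
have := lie_phi_form a X (phi Y); rewrite -/(Q _) QphiE gNr gphi opprK.
rewrite (lie_phi_form a (phi X) Y) !phi2 !gE => e.
by apply: (eq_of_lincomb (lincombN e)); rewrite !(gC (Z _)) !gAZ; ring.
Qed.

(** Under [phi] the symmetric part of [A a] changes sign by [gAsym_phi], and the skew part is
    invariant by [d_phi]. *)
Lemma shape_adj a X Y : g (A a X) Y = g X (phi (A a (phi Y))).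
Proof.
apply: eq_two; rewrite gphi.
have h1 := gAsym_phi a X Y; have := d_phi a X Y; rewrite /d => h2.
by apply: (eq_of_lincomb (lincombD h1 (lincombN h2))); ring.
Qed.

Lemma nab_reeb_phi a X : nab (Z a) (phi X) = phi (nab (Z a) X).
Proof.
apply/subr0_eq/g_definite; set U := _ - _; rewrite {2}/U lie_phi_form.
by rewrite shape_adj shape_phi2 phiN gNr gphi; ring.
Qed.

Lemma nab_reeb_shape a b X :
  nab (Z a) (A b X) = A b (nab (Z a) X) - A b (A a X).
Proof.
have := nab_flat X (Z a) (Z b); rewrite /br -!/(A _ _) shape_reeb nab0 AB => e.
apply: g_inj => W; have := congr1 (g^~ W) e; rewrite !gE => {}e.
by apply: (eq_of_lincomb (lincombN e)); ring.
Qed.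

(** The derivative of [shape_adj] along [Z a], where [phi] is parallel. *)
Let shape_shape_adj a b X Y : g (A b (A a X)) Y = g X (phi (A b (A a (phi Y)))).
Proof.
have := congr1 (der (Z a)) (shape_adj b X Y).
rewrite !nab_metric !(nab_reeb_phi, nab_reeb_shape) !(phiB, gE) => e.
have e1 := shape_adj b (nab (Z a) X) Y; have e2 := shape_adj b X (nab (Z a) Y).
apply: (eq_of_lincomb (lincombD e1 (lincombD e2 (lincombN e)))); ring.
Qed.

(** Applying [shape_adj] factor by factor leaves [phi o phi] in the middle, hence a minus sign
    compared with [shape_shape_adj]. *)
Lemma shape_anticomm a b X : A a (A b X) = - A b (A a X).
Proof.
apply: g_inj => Y; rewrite gNl [LHS]shape_adj [LHS]shape_adj shape_phi2 phiN gNr.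
by rewrite -shape_shape_adj.
Qed.

Lemma shape_sq b X : A b (A b X) = 0.
Proof. by apply: two_injV; rewrite {2}shape_anticomm subrr. Qed.

(* Twice the orthogonal projection onto the part of the contact distribution
   on which [d b] is nondegenerate. *)
Let M b X := locked (phi (A b X) + A b (phi X)).

Let ME b X : M b X = phi (A b X) + A b (phi X).
Proof. by rewrite /M -lock. Qed.

Let gM b X W : g (M b X) W = d b (phi X) W.
Proof.
have e := shape_adj b X (phi W); rewrite shape_phi2 phiN gNr !gphi opprK in e.
by rewrite ME /d gDl; apply: (eq_of_lincomb (lincombN e)); ring.
Qed.

Let AM b X : A b (M b X) = M b (A b X).
Proof. by rewrite !ME AD !shape_sq phi0 addr0 add0r. Qed.

Let MM b X : M (~~ b) X = - (phi (phi X) *+ 2) - M b X.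
Proof.
apply: g_inj => W; rewrite mulr2n !gE !gM.
have h : d true (phi X) W + d false (phi X) W = - (g (phi (phi X)) W *+ 2).
  by rewrite -gphi_d gphi mulNrn.
by apply: (eq_of_lincomb h); case: b; rewrite mulr2n /=; ring.
Qed.

Let AMn b X : A b (M (~~ b) X) = M (~~ b) (A b X).
Proof.
by rewrite !MM !(AB, AN, AD, mulr2n) AM shape_phi2 phi2_shape.
Qed.

Let gM_sym b X W : g (M b X) W = g X (M b W).
Proof.
rewrite (gC X) !gM -d_phi /d !shape_phi2 phi2 !gE !(gC (Z _)) !gAZ.
by rewrite (gC (phi W)) (gC X); ring.
Qed.

(** [M (~~ b)] maps into the kernel of [d b], so its composite with [A b] is symmetric; the two
    commute and [A b] has square zero, so the composite vanishes by definiteness. *)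
Lemma shape_split b X : A b (M (~~ b) X) = 0.
Proof.
have sym U W : g (A b (M (~~ b) U)) W = g U (A b (M (~~ b) W)).
  rewrite [in RHS]AMn -gM_sym; apply/subr0_eq; apply: (@d_split b U) => W'.
  exact: gM.
by apply: g_definite; rewrite sym -AMn shape_sq g0r.
Qed.

Let MA b X : M (~~ b) (A b X) = 0.
Proof. by rewrite -AMn shape_split. Qed.

Let two_shape b X : M b (A b X) = A b X + A b X.
Proof.
rewrite -{1}[b]negbK MM MA phi2_shape mulr2n; apply: g_inj => W.
by rewrite !gE; ring.
Qed.

Lemma shape_shape a b X : A a (A b X) = 0.
Proof.
have [->|ab] := eqVneq a b; first exact: shape_sq.
have {ab} -> : b = ~~ a by case: a b ab => [] [].
apply: two_injV; rewrite -AD -two_shape; exact: shape_split.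
Qed.

(** * The sum of the shape operators and its eigenspace *)

Let T X := A true X + A false X.

Let TD X Y : T (X + Y) = T X + T Y.
Proof. by rewrite /T !AD addrACA. Qed.

Let TB X Y : T (X - Y) = T X - T Y.
Proof. by rewrite TD; congr (_ + _); rewrite /T !AN opprD. Qed.

Let TT X : T (T X) = 0.
Proof. by rewrite /T !AD !shape_shape !addr0. Qed.

Let T_adj X Y : g (T X) Y = g X (phi (T (phi Y))).
Proof. by rewrite /T phiD gDl gDr !shape_adj. Qed.

Let Tphi X : phi (T X) + T (phi X) = - (phi (phi X) *+ 2).
Proof.
rewrite /T phiD addrACA -!ME -[RHS](subrK (M true X)) -(MM true).
by rewrite addrC.
Qed.

Let gTZ b X : g (T X) (Z b) = 0.
Proof. by rewrite gDl !gAZ addr0. Qed.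

Let phi2_T X : phi (phi (T X)) = - T X.
Proof. by rewrite /T !phiD !phi2_shape opprD. Qed.

Let TphiT X : T (phi (T X)) = T X + T X.
Proof.
by have := Tphi (T X); rewrite TT phi0 add0r phi2_T mulNrn opprK.
Qed.

(* The eigenspace [T X = - 2 phi X]; the contact distribution is the orthogonal
   sum of it and of its image by [phi], which is killed by [T]. *)
Let E X := phi (T X) = X + X.

Let E_phiT X : E (phi (T X)).
Proof. by rewrite /E TphiT phiD. Qed.

Let E_Z X b : E X -> g X (Z b) = 0.
Proof. by move=> EX; apply: two_inj; rewrite -gDl -EX gphiZ. Qed.

Let E_phi2 X : E X -> phi (phi X) = - X.
Proof.
by move=> EX; rewrite phi2 !E_Z // !scale0r !addr0.
Qed.

Let E_T X : E X -> T X = - (phi X + phi X).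
Proof. by move=> EX; rewrite -phiD -EX phi2_T opprK. Qed.

Let E_Tphi X : E X -> T (phi X) = 0.
Proof.
move=> EX; have := Tphi X; rewrite EX E_phi2 // mulNrn opprK mulr2n.
by rewrite -[RHS]addr0 => /addrI.
Qed.

(** [M b] separates the summands of [T (phi X) = 0]: it doubles the image of [A b] and kills that of
    the other shape operator. *)
Let E_shape_phi b X : E X -> A b (phi X) = 0.
Proof.
move=> EX; apply: two_injV; rewrite -two_shape.
have : M b (T (phi X)) = 0 by rewrite E_Tphi // ME A0 !phi0 A0 addr0.
have MD U W : M b (U + W) = M b U + M b W.
  by rewrite !ME !(AD, phiD) addrACA.
rewrite /T MD; case: b {MD} (MA true (phi X)) (MA false (phi X)) => /= h1 h2.
  by rewrite h2 addr0.
by rewrite h1 add0r.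
Qed.

Let gAE b X W : E W -> g (A b X) W = 0.
Proof. by move=> EW; rewrite shape_adj E_shape_phi // phi0 g0r. Qed.

Let gTE X W : E W -> g (T X) W = 0.
Proof. by move=> EW; rewrite gDl !gAE // addr0. Qed.

Let gEphiE X W : E X -> E W -> g X (phi W) = 0.
Proof.
move=> EX EW; apply: two_inj; rewrite -gDl -EX gphi2 !gTZ !mul0r !subr0; exact: gTE.
Qed.

(** * The connection on the eigenspace *)

Let nabT X Y : nab X (T Y) - nab Y (T X) = T (br X Y).
Proof.
have := congr2 +%R (nab_flat X Y (Z true)) (nab_flat X Y (Z false)).
rewrite -!/(A _ _) addr0 => e; apply: g_inj => W.
have := congr1 (g^~ W) e; rewrite /T !nabD !gE => {}e.
by apply: (eq_of_lincomb e); ring.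
Qed.

Let E_codazzi X Y W : E X -> E Y ->
  g (nab X (phi Y)) W - g (nab Y (phi X)) W + g (nab X (phi Y)) W -
    g (nab Y (phi X)) W = - g (T (br X Y)) W.
Proof.
move=> EX EY; have := congr1 (g^~ W) (nabT X Y).
by rewrite (E_T EX) (E_T EY) !nabN !nabD !gE => <-; ring.
Qed.

Let E_sym X Y W : E X -> E Y -> E W ->
  g (nab X (phi Y)) W = g (nab Y (phi X)) W.
Proof.
move=> EX EY EW; have := E_codazzi W EX EY; rewrite gTE // => e.
by apply: eq_two; apply: (eq_of_lincomb e); ring.
Qed.

(** For [W] in [E], the failure of [nab X] to commute with [phi], paired with [phi W]. *)
Let t X Y W := g (nab X (phi Y)) (phi W) - g (nab X Y) W.

Let gT_phi U W : E W -> g (T U) (phi W) = - (g U W + g U W).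
Proof.
move=> EW; rewrite T_adj E_phi2 //.
have -> : T (- W) = phi (W + W).
  by rewrite -[X in T X]add0r TB -EW phi2_T /T !A0 addr0 sub0r.
by rewrite E_phi2 ?gNr ?gDr // /E TD phiD EW.
Qed.

Let t_sym X Y W : E X -> E Y -> E W -> t X Y W = t Y X W.
Proof.
move=> EX EY EW; have := E_codazzi (phi W) EX EY; rewrite gT_phi // => e.
apply: eq_two; apply: (eq_of_lincomb e).
by rewrite /t /br !gE; ring.
Qed.

Let t_skew X Y W : E Y -> E W -> t X Y W = - t X W Y.
Proof.
move=> EY EW; have := nab_metric X (phi Y) (phi W).
rewrite gphi2 !E_Z // !mul0r !subr0 nab_metric => e.
by apply: (eq_of_lincomb (esym e)); rewrite /t !(gC Y) !(gC (phi Y)); ring.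
Qed.

(** A form symmetric in its first two arguments and skew in its last two vanishes: alternating three
    swaps of each kind gives [t = - t]. *)
Let nabE_phi_phi X Y W : E X -> E Y -> E W ->
  g (nab X (phi Y)) (phi W) = g (nab X Y) W.
Proof.
move=> EX EY EW; apply/subr0_eq/two_inj; rewrite -/(t X Y W).
rewrite {1}(t_sym EX) // (t_skew Y EX EW) (t_sym EY EW) // (t_skew W EY EX).
by rewrite (t_sym EW EX) // (t_skew X EW EY) opprK addNr.
Qed.

(** The same swapping argument, with [b] symmetric in its first two arguments and skew in the first
    and third. *)
Let nabE_phi_E X Y W : E X -> E Y -> E W -> g (nab X (phi Y)) W = 0.
Proof.
pose b X Y W := g (nab X (phi Y)) W; rewrite -/(b X Y W).
(* Codazzi equation for [phi X'] and [Y'], where [T (phi X') = 0]. *)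
have b_t X' Y' W' : E X' -> E Y' -> E W' -> b Y' X' W' = - t (phi X') Y' W'.
  move=> EX EY EW; have := congr1 (g^~ (phi W')) (nabT (phi X') Y').
  rewrite E_Tphi // nab0 subr0 (E_T EY) nabN nabD gT_phi // !gE => e.
  by apply: eq_two; apply: (eq_of_lincomb (lincombN e)); rewrite /t /b; ring.
have b_skew X' Y' W' : E X' -> E Y' -> E W' -> b X' Y' W' = - b W' Y' X'.
  by move=> EX EY EW; rewrite !b_t // t_skew.
have b_sym X' Y' W' : E X' -> E Y' -> E W' -> b X' Y' W' = b Y' X' W'.
  exact: E_sym.
move=> EX EY EW; apply: two_inj.
rewrite {1}(b_sym X) // (b_skew Y) // (b_sym W) // (b_skew X W) //.
by rewrite (b_sym Y W) // (b_skew W Y) // opprK addNr.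
Qed.

Let nabE_Z X Y b : E X -> E Y -> g (nab X Y) (Z b) = 0.
Proof.
move=> EX EY; have := nab_metric X Y (Z b).
by rewrite E_Z // der0 -/(A b X) (gC Y) gAE // addr0.
Qed.

Let nabE_phiE X Y W : E X -> E Y -> E W -> g (nab X Y) (phi W) = 0.
Proof.
move=> EX EY EW; have := nab_metric X Y (phi W).
by rewrite gEphiE // der0 (gC Y) nabE_phi_E // addr0.
Qed.

Let Tphi_phi X : T (phi X) = phi (phi (T (phi (- X)))).
Proof. by rewrite phi2_T phiN /T !AN opprD !opprK. Qed.

(** Orthogonality of [nab X Y] to [phi E] and to the Reeb fields gives [T (phi U) = 0], which [Tphi]
    turns into membership in [E]. *)
Let E_nab X Y : E X -> E Y -> E (nab X Y).
Proof.
move=> EX EY; set U := nab X Y.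
have UZ b : g U (Z b) = 0 by exact: nabE_Z.
have TU : T (phi U) = 0.
  apply: g_inj => W; rewrite g0l T_adj gphi2 !UZ !mul0r !subr0 Tphi_phi.
  by apply: nabE_phiE => //; exact: E_phiT.
have := Tphi U; rewrite TU addr0 phi2 !UZ !scale0r !addr0 mulNrn opprK.
by rewrite /E mulr2n.
Qed.

(** Minus the component of [nab X (phi Y)] along [Z b]. *)
Let beta b X Y := g (phi Y) (A b X).

Let nabE_phi X Y : E X -> E Y -> nab X (phi Y) =
  phi (nab X Y) - (beta true X Y *: Z true + beta false X Y *: Z false).
Proof.
move=> EX EY; apply/subr0_eq; set D := _ - _.
have UZ b : g (nab X Y) (Z b) = 0 by exact: nabE_Z.
have DZ b : g D (Z b) = 0.
  have := nab_metric X (phi Y) (Z b); rewrite gphiZ der0 -/(A b X) -/(beta b X Y).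
  rewrite /D !gE gphiZ !gZZ => e; apply: (eq_of_lincomb (esym e)).
  by case: b {e} => /=; ring.
have gDE W : E W -> g D W = 0.
  move=> EW; rewrite /D !gE !(gC (Z _)) !E_Z // nabE_phi_E //.
  by rewrite -[g (phi _) _]opprK -gphi nabE_phiE //; ring.
have gDphiE W : E W -> g D (phi W) = 0.
  move=> EW; rewrite /D !gE !(gC (Z _)) !gphiZ nabE_phi_phi // gphi2 !UZ.
  by ring.
clearbody D; apply: g_inj => W; rewrite g0l.
(* By [Tphi], [- 2 phi (phi W)] is the sum of [phi (T W)] in [E] and [T (phi W)] in [phi E]. *)
have e : g D (phi (phi W) *+ 2) = 0.
  have := gDphiE _ (E_phiT (phi (- W))); rewrite -Tphi_phi => h.
  by rewrite -[_ *+ 2]opprK -Tphi gNr gDr h (gDE _ (E_phiT W)) addr0 oppr0.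
apply: two_inj; rewrite mulr2n phi2 !gE !DZ in e.
by apply: (eq_of_lincomb (lincombN e)); ring.
Qed.

(* Curvature on the totally geodesic distribution [E]: [nab] commutes with
   [phi] up to a Reeb component, whose derivative is a shape operator. *)
Let E_gauss X Y W U : E X -> E Y -> E W ->
  beta true Y W * g (A true X) U + beta false Y W * g (A false X) U =
  beta true X W * g (A true Y) U + beta false X W * g (A false Y) U.
Proof.
move=> EX EY EW.
have E_br : E (br X Y).
  by rewrite /br /E TB phiB !E_nab // opprD addrACA.
(* Testing against [phi (phi U)], orthogonal to the Reeb fields, discards the Reeb components. *)
have gA_phi2 b X' : g (A b X') (phi (phi U)) = - g (A b X') U.
  by rewrite gphi gphi2 !gAZ !mul0r !subr0.
have nabnab X' Y' : E X' -> E Y' ->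
    g (nab X' (nab Y' (phi W))) (phi (phi U)) =
    g (phi (nab X' (nab Y' W))) (phi (phi U)) +
    (beta true Y' W * g (A true X') U + beta false Y' W * g (A false X') U).
  move=> EX' EY'; rewrite (nabE_phi EY' EW) nabD nabN nabD !nabZ.
  rewrite (nabE_phi EX' (E_nab EY' EW)) -!/(A _ _) !gE !gA_phi2.
  by rewrite !(gC (Z _)) !gphiZ; ring.
have nab_br : g (nab (br X Y) (phi W)) (phi (phi U)) =
    g (phi (nab (br X Y) W)) (phi (phi U)).
  by rewrite (nabE_phi E_br EW) !gE !(gC (Z _)) !gphiZ; ring.
have e1 := congr1 (fun S => g S (phi (phi U))) (nab_flat X Y (phi W)).
have e2 := congr1 (fun S => g (phi S) (phi (phi U))) (nab_flat X Y W).
rewrite /= !gDl !gNl !nabnab // nab_br g0l in e1.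
rewrite /= !phiB phi0 !gDl !gNl g0l in e2.
by apply: (eq_of_lincomb (lincombD e1 (lincombN e2))); ring.
Qed.

(** * Minors of the shape operators *)

Let shape_phiT b X : A b (phi (T X)) = A b X + A b X.
Proof.
have e c : A b (phi (A c X)) = A b (M c X) by rewrite ME AD shape_shape addr0.
rewrite /T phiD AD !e; have h := shape_split b X.
by case: b {e} h => /= h; rewrite AM two_shape h ?addr0 ?add0r.
Qed.

Let gTphi_shape b X Y : g (T (phi X)) (A b Y) = g X (A b Y) + g X (A b Y).
Proof.
have := congr1 (g^~ (A b Y)) (Tphi X).
rewrite /= gDl (gC (phi (T X))) gAE ?add0r; last exact: E_phiT.
by move=> ->; rewrite mulr2n gNl gDl phi2 !gE !(gC (Z _)) !gAZ; ring.
Qed.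

Lemma shape_minor b X Y V' W :
  g V' (A b X) * g W (A b Y) = g V' (A b Y) * g W (A b X).
Proof.
(* Testing [E_gauss] against [M b U] isolates [A b], as [M b] kills the image of the other shape
   operator. *)
have h X' Y' V1 U : E X' -> E Y' -> E V1 ->
    beta b X' V1 * g (A b Y') U = beta b Y' V1 * g (A b X') U.
  move=> EX EY EV; have := E_gauss (M b U) EY EX EV; rewrite -!gM_sym.
  have := MA true; have := MA false; case: b => /= m1 m2.
    rewrite !m1 !two_shape !g0l !mulr0 !addr0 !gDl => e.
    by apply: eq_two; apply: (eq_of_lincomb e); ring.
  rewrite !m2 !two_shape !g0l !mulr0 !add0r !gDl => e.
  by apply: eq_two; apply: (eq_of_lincomb e); ring.
have := h _ _ _ W (E_phiT X) (E_phiT Y) (E_phiT (phi (- V'))).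
rewrite /beta -Tphi_phi !gTphi_shape !shape_phiT !gDl !gDr !(gC W) => e.
(* Projecting [X], [Y] and [V'] to [E] costs a factor 2 each. *)
by do 3!apply: eq_two; apply: (eq_of_lincomb e); ring.
Qed.

End Flat_contact_pair.

(** * Alternating forms on a vector space *)

Section Pointwise_forms.
Local Open Scope ring_scope.
Context {R : realFieldType} {V : lmodType R}.
Implicit Types (p q : nat) (X Y : V).

(** * Wedge products at a point *)

Definition pform p := ('I_p -> V) -> R.

Definition pwedge p q (F : pform p) (G : pform q) : pform (p + q) :=
  fun v => (p + q)`!%:R^-1 *
    \sum_(s : 'S_(p + q)) (-1) ^+ s *
      (F (fun i => v (s (lshift q i))) * G (fun j => v (s (rshift p j)))).

Fixpoint pwedge_exp p (F : pform p) m : pform (m * p) :=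
  match m with
  | 0 => fun=> 1
  | m'.+1 => pwedge F (pwedge_exp F (m := m'))
  end.
Arguments pwedge_exp {p} F m _.

Definition pform2 (w : V -> V -> R) : pform 2 :=
  fun v => w (v ord0) (v ord_max).

Definition skew p (F : pform p) :=
  forall (t : 'S_p) v, F (fun i => v (t i)) = (-1) ^+ t * F v.

Definition annihilated p (F : pform p) (u : V) :=
  forall v i, v i = u -> F v = 0.

Definition subst_arg p (v : 'I_p -> V) i X : 'I_p -> V :=
  fun k => if k == i then X else v k.

Definition multilinear p (F : pform p) :=
  forall v i (c : R) X Y, F (subst_arg v i (c *: X + Y)) =
    c * F (subst_arg v i X) + F (subst_arg v i Y).

Lemma pwedge_skew p q (F : pform p) (G : pform q) : skew (pwedge F G).
Proof.
move=> t v; rewrite /pwedge mulrCA; congr (_ * _).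
rewrite mulr_sumr [RHS](reindex_inj (mulIg t)) /=; apply: eq_bigr => s _.
rewrite odd_permM signr_addb [X in _ = _ * (X * _)]mulrC !mulrA -signr_addb.
rewrite addbb mul1r; congr (_ * _ * _).
  by congr F; apply: funext => i; rewrite permM.
by congr G; apply: funext => i; rewrite permM.
Qed.

Lemma pwedge_exp_skew p (F : pform p) m : skew (pwedge_exp F m).
Proof.
case: m => [|m]; last exact: pwedge_skew.
move=> t v; rewrite /= (_ : t = 1%g) ?odd_perm1 ?mul1r //.
by apply/permP => -[i lt_i]; have : (i < 0)%N := lt_i.
Qed.

Lemma skew_repeat p (F : pform p) v i j :
  skew F -> i != j -> v i = v j -> F v = 0.
Proof.
move=> skF ij vij; have := skF (tperm i j) v.
rewrite odd_tperm ij expr1 mulN1r (_ : (fun _ => _) = v); first by lra.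
by apply: funext => k; case: tpermP => // ->.
Qed.

Lemma annihilated_pwedge p q (F : pform p) (G : pform q) u :
  annihilated F u -> annihilated G u -> annihilated (pwedge F G) u.
Proof.
move=> aF aG v i vi; rewrite /pwedge big1 ?mulr0 // => s _.
case: (split_ordP ((s^-1)%g i)) => k /(canRL (permKV s)) ik.
  by rewrite (aF _ k) ?mul0r ?mulr0 // -ik.
by rewrite (aG _ k) ?mulr0 // -ik.
Qed.

Lemma annihilated_pwedge_exp p (F : pform p) m u :
  annihilated F u -> annihilated (pwedge_exp F m) u.
Proof.
move=> aF; elim: m => [|m IH] /=; last exact: annihilated_pwedge.
by move=> v [i lt_i]; have : (i < 0)%N := lt_i.
Qed.

Let subst_argE p r (h : 'I_p -> 'I_r) (v : 'I_r -> V) k X : injective h ->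
  (fun i => subst_arg v (h k) X (h i)) = subst_arg (fun i => v (h i)) k X.
Proof.
by move=> hI; apply: funext => i; rewrite /subst_arg (inj_eq hI).
Qed.

Let subst_argN p r (h : 'I_p -> 'I_r) (v : 'I_r -> V) k X :
  (forall i, h i != k) -> (fun i => subst_arg v k X (h i)) = (fun i => v (h i)).
Proof.
by move=> hk; apply: funext => i; rewrite /subst_arg (negPf (hk i)).
Qed.

Lemma multilinear_pwedge p q (F : pform p) (G : pform q) :
  multilinear F -> multilinear G -> multilinear (pwedge F G).
Proof.
move=> lF lG v i c X Y; rewrite /pwedge mulrCA -mulrDr [c * _]mulr_sumr.
rewrite -big_split /=.
congr (_ * _); apply: eq_bigr => s _.
have sl : injective (fun k => s (lshift q k)) by move=> ? ? /perm_inj/lshift_inj.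
have sr : injective (fun k => s (rshift p k)) by move=> ? ? /perm_inj/rshift_inj.
case: (split_ordP ((s^-1)%g i)) => k /(canRL (permKV s)) ->.
  rewrite !(subst_argE v k _ sl) lF.
  have N j : s (rshift p j) != s (lshift q k).
    by rewrite (inj_eq perm_inj) eq_rlshift.
  rewrite !(fun X' => subst_argN v X' N).
  by move: (_ ^+ _) (F _) (F _) (G _) => e a b d; ring.
rewrite !(subst_argE v k _ sr) lG.
have N j : s (lshift q j) != s (rshift p k).
  by rewrite (inj_eq perm_inj) eq_lrshift.
rewrite !(fun X' => subst_argN v X' N).
by move: (_ ^+ _) (F _) (G _) (G _) => e a b d; ring.
Qed.

Lemma multilinear_pwedge_exp p (F : pform p) m :
  multilinear F -> multilinear (pwedge_exp F m).
Proof.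
move=> lF; elim: m => [|m IH] /=; last exact: multilinear_pwedge.
by move=> v [i lt_i]; have : (i < 0)%N := lt_i.
Qed.

(** Substituting the combination for [v i] leaves [mu i * F v], since every other term repeats a
    vector. *)
Lemma skew_free p (F : pform p) (v : 'I_p -> V) (mu : 'I_p -> R) :
  skew F -> multilinear F -> F v != 0 ->
  annihilated F (\sum_j mu j *: v j) -> forall i, mu i = 0.
Proof.
move=> skF lF Fv0 aF i; apply: contraNeq Fv0 => mui0.
have := aF (subst_arg v i (\sum_j mu j *: v j)) i; rewrite /subst_arg eqxx.
move=> /(_ erefl); rewrite -/(subst_arg v i _).
have lin0 : F (subst_arg v i 0) = 0.
  by have := lF v i (-1) 0 0; rewrite scaler0 addr0 mulN1r addNr.
have -> : F (subst_arg v i (\sum_j mu j *: v j)) =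
    \sum_j mu j * F (subst_arg v i (v j)).
  elim/big_rec2: _ => [|j y1 y2 _ <-]; first exact: lin0.
  exact: lF.
rewrite (bigD1 i) //= big1 ?addr0 => [|j ji]; last first.
  have ij : i != j by rewrite eq_sym.
  by rewrite (skew_repeat skF ij) ?mulr0 // /subst_arg eqxx (negPf ji).
move=> /eqP; rewrite mulf_eq0 (negPf mui0) /= (_ : subst_arg v i (v i) = v) //.
by apply: funext => k; rewrite /subst_arg; case: eqP => // ->.
Qed.

Lemma sum_lift_perm n (F : 'S_n.+1 -> R) :
  \sum_s F s = \sum_(i < n.+1) \sum_(t : 'S_n) F (lift_perm ord0 i t).
Proof.
pose h (u : 'I_n.+1 * 'S_n) := lift_perm ord0 u.1 u.2.
have hI : injective h.
  move=> [i t] [j u] /permP e; have := e ord0; rewrite !lift_perm_id /= => ij.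
  rewrite -{}ij in e *; congr (_, _); apply/permP => k.
  by have := e (lift ord0 k); rewrite !lift_perm_lift => /lift_inj.
rewrite pair_bigA (reindex h) //=; apply: onW_bij; apply: inj_card_bij => //.
by rewrite card_prod card_ord !card_Sn.
Qed.

(** Laplace expansion: [i] and [bump i j] are the images of the first two positions, and by skewness
    of [G] the [q!] arrangements of the rest contribute equally. Indexing [v] by [nat] lets [bump]
    compose freely. *)
Lemma pwedge_form2 q (w : V -> V -> R) (G : pform q) (v : nat -> V) : skew G ->
  pwedge (pform2 w) G (fun i => v i) = (2 + q)`!%:R^-1 * (q`!%:R *
    \sum_(i < q.+2) \sum_(j < q.+1) (-1) ^+ (i + j) * w (v i) (v (bump i j)) *
      G (fun k => v (bump i (bump j k)))).
Proof.
move=> skG; rewrite /pwedge; congr (_ * _); rewrite sum_lift_perm mulr_sumr.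
apply: eq_bigr => i _; rewrite sum_lift_perm mulr_sumr; apply: eq_bigr => j _.
rewrite -[q`!]card_Sn -sum1_card natr_sum mulr_suml; apply: eq_bigr => u _.
rewrite !odd_lift_perm /= mul1r.
have e0 : lshift q (ord0 : 'I_2) = ord0 :> 'I_q.+2 by exact: val_inj.
have e1 : lshift q (ord_max : 'I_2) = lift ord0 ord0 :> 'I_q.+2.
  exact: val_inj.
rewrite /pform2 e0 e1 lift_perm_lift !lift_perm_id /=.
have -> : (fun k : 'I_q => v (lift_perm ord0 i (lift_perm ord0 j u) (rshift 2 k)))
    = (fun k => v (bump i (bump j (u k)))).
  apply: funext => k; have -> : rshift 2 k = lift ord0 (lift ord0 k) :> 'I_q.+2.
    exact: val_inj.
  by rewrite !lift_perm_lift.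
rewrite (skG u (fun k => v (bump i (bump j k)))).
rewrite (signr_addb _ (odd i)) (signr_addb _ (odd j)) !signr_odd.
rewrite exprD; have := sqrr_sign R u; move: ((-1) ^+ u) ((-1) ^+ i) ((-1) ^+ j).
by move: (w _ _) (G _) => a b c d f e; rewrite -[RHS]mul1r -e; ring.
Qed.

(** * Symplectic families *)

Definition alternating_bilinear (w : V -> V -> R) :=
  (forall c X Y W, w (c *: X + Y) W = c * w X W + w Y W) /\
  (forall X Y, w X Y = - w Y X).

Lemma alternating_linear_r w c X Y W : alternating_bilinear w ->
  w W (c *: X + Y) = c * w W X + w W Y.
Proof. by move=> [wl wC]; rewrite !(wC W) wl opprD mulrN. Qed.

Lemma multilinear_pform2 w : alternating_bilinear w -> multilinear (pform2 w).
Proof.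
move=> aw v i c X Y; have [wl _] := aw; rewrite /pform2 /subst_arg.
case: (unliftP ord0 i) => [j|] ->; last by rewrite eqxx /= wl.
rewrite (ord1 j) (_ : lift ord0 ord0 = ord_max) ?eqxx; last exact: val_inj.
exact: alternating_linear_r.
Qed.

Lemma annihilated_pform2 w u : alternating_bilinear w ->
  (forall Y, w u Y = 0) -> annihilated (pform2 w) u.
Proof.
move=> [_ wC] wu v i vi; rewrite /pform2.
case: (unliftP ord0 i) vi => [j|] ->; last by move=> ->.
rewrite (ord1 j) (_ : lift ord0 ord0 = ord_max); last exact: val_inj.
by move=> ->; rewrite wC wu oppr0.
Qed.

(** The Gram matrix of a Darboux basis ordered in consecutive pairs [2 i], [2 i + 1]. *)
Definition std_symplectic a b : R :=
  if odd a then - (a == b.+1)%:R else (b == a.+1)%:R.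

Definition symplectic_family (w : V -> V -> R) m (v : nat -> V) :=
  forall a b, (a < m * 2)%N -> (b < m * 2)%N ->
    w (v a) (v b) = std_symplectic a b.

(** Once [i] is removed, its partner sits at position [i - odd i], so the two bumps skip a whole
    pair. *)
Let bump_pair i k : bump i (bump (i - odd i) k) =
  (if (k < i - odd i)%N then k else k.+2).
Proof.
rewrite /bump; set c := (i - odd i)%N.
have ic : (c <= i <= c.+1)%N by rewrite /c; case: (odd i) => /=; lia.
case: (ltnP k c) => kc; rewrite ?add0n ?add1n.
  by have -> : (i <= k)%N = false by lia.
by have -> : (i <= k.+1)%N = true by lia.
Qed.

Lemma symplectic_family_bump w m v i : (i < m.+1 * 2)%N ->
  symplectic_family w m.+1 v ->
  symplectic_family w m (fun k => v (bump i (bump (i - odd i) k))).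
Proof.
move=> lti hv a b lta ltb; rewrite !bump_pair.
have ev : ~~ odd (i - odd i).
  by rewrite oddB ?oddb ?addbb //; case: (i) => // k; case: odd.
move: (i - odd i)%N ev => c ev.
rewrite hv; try by case: ifP => _; lia.
have evN k : odd k -> k != c by apply: contraTneq => ->.
have evS k : ~~ odd k -> k.+1 != c by move=> ek; apply: contraNneq ev => <- /=.
rewrite /std_symplectic; case: (ltnP a c) => ac; case: (ltnP b c) => bc //=;
  rewrite ?negbK //; case: ifP => oa.
- by congr (- _%:R); lia.
- by have := evS _ (negbT oa) => /eqP h; congr (_%:R); lia.
- by have := evN _ oa => /eqP h; congr (- _%:R); lia.
- by congr (_%:R); lia.
Qed.

(** In [pwedge_form2] only the partner of [i] contributes, its sign cancels that of [w], and what
    remains is the same power for one pair less. *)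
Lemma symplectic_family_pwedge_exp w m v : symplectic_family w m v ->
  0 < pwedge_exp (pform2 w) m (fun i => v i).
Proof.
elim: m v => [|m IH] v hv /=; first exact: ltr01.
rewrite pwedge_form2; last exact: pwedge_exp_skew.
rewrite !mulr_gt0 ?invr_gt0 ?ltr0n ?fact_gt0 //.
pose G i j := pwedge_exp (pform2 w) m (fun k => v (bump i (bump j k))).
have inner (i : 'I_(m * 2).+2) :
    \sum_(j < (m * 2).+1) (-1) ^+ (i + j) * w (v i) (v (bump i j)) * G i j =
    G i (i - odd i)%N.
  have lti := ltn_ord i.
  have ltj : (i - odd i < (m * 2).+1)%N.
    by have := odd_double_half i; case: (odd i); lia.
  have one : (-1) ^+ (i + (i - odd i)) * w (v i) (v (bump i (i - odd i))) = 1.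
    rewrite hv /std_symplectic /bump //; last by case: leqP; lia.
    case oi: (odd i) => /=; last first.
      by rewrite subn0 leqnn add1n eqxx mulr1 -signr_odd oddD oi.
    have i0 : (0 < i)%N by case: (nat_of_ord i) oi.
    have -> : (i <= i - 1)%N = false by lia.
    have -> : (nat_of_ord i == (false + (i - 1)).+1)%N by lia.
    by rewrite -signr_odd oddD oddB // oi /= expr1 mulrNN mulr1.
  have zero (j : 'I_(m * 2).+1) : (j <> i - odd i :> nat)%N ->
      w (v i) (v (bump i j)) = 0.
    move=> ji; rewrite hv // /std_symplectic /bump; last first.
      by case: leqP; have := ltn_ord j; lia.
    case oi: (odd i) ji => /= ji.
      rewrite (_ : (_ == _) = false) ?oppr0 //.
      by apply/eqP; case: leqP => /= h; lia.
    rewrite (_ : (_ == _) = false) //.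
    by apply/eqP; case: leqP => /= h; lia.
  rewrite (bigD1 (Ordinal ltj)) //= one mul1r big1 ?addr0 // => j ji.
  rewrite zero ?mulr0 ?mul0r // => e; move/eqP: ji; apply; exact: val_inj.
have pos (i : 'I_(m * 2).+2) : 0 < G i (i - odd i)%N.
  apply: (IH (fun k => v (bump i (bump (i - odd i) k)))).
  exact: symplectic_family_bump.
rewrite (eq_bigr (fun i : 'I_(m * 2).+2 => G i (i - odd i)%N)) => [|i _] //.
rewrite (bigD1 ord0) //=; apply: ltr_wpDr; last exact: (pos ord0).
by apply: sumr_ge0 => i _; exact/ltW/pos.
Qed.

(** Symplectic Gram-Schmidt: split off a pair [e], [f] and recurse on its [w]-orthogonal inside [S],
    until [w] vanishes on the rest or [m.+1] pairs are found. *)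
Lemma darboux_dichotomy (w : V -> V -> R) m (S : V -> Prop) :
  alternating_bilinear w -> (forall c X Y, S X -> S Y -> S (c *: X + Y)) ->
  (exists u : nat -> V, forall X, S X ->
     (forall j, (j < m * 2)%N -> w (u j) X = 0) -> forall Y, S Y -> w X Y = 0) \/
  (exists2 v, symplectic_family w m.+1 v & forall k, (k < m.+1 * 2)%N -> S (v k)).
Proof.
move=> [wl wC].
have wr c X Y W := @alternating_linear_r w c X Y W (conj wl wC).
have ww X : w X X = 0 by have := wC X X; lra.
have w0r X : w X 0 = 0 by have := wr (-1) 0 0 X; rewrite scaler0 addr0; lra.
have pairP (S' : V -> Prop) : (forall c X Y, S' X -> S' Y -> S' (c *: X + Y)) ->
    (exists e f, [/\ S' e, S' f & w e f = 1]) \/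
    (forall X Y, S' X -> S' Y -> w X Y = 0).
  move=> lS'; have [|w0] := pselect (exists e f, [/\ S' e, S' f & w e f != 0]).
    move=> [e [f [Se Sf ef]]]; left; exists e, ((w e f)^-1 *: f + 0).
    have S0 : S' 0 by have := lS' (-1) _ _ Se Se; rewrite scaleN1r addNr.
    split=> //; first exact: lS'.
    by rewrite wr w0r addr0 mulVf.
  right=> X Y SX SY; apply: contra_notP w0 => /eqP XY.
  by exists X, Y.
elim: m S => [|m IH] S lS;
  have [[e [f [Se Sf ef]]]|w0] := pairP S lS;
  try by left; exists (fun=> 0) => X SX _ Y; exact: w0.
  right; exists (fun k => if k == 0%N then e else f); last by case.
  move=> [|[|a]] [|[|b]] //= _ _; rewrite /std_symplectic /= ?ww ?oppr0 //.
  by rewrite wC ef.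
pose S' X := [/\ S X, w e X = 0 & w f X = 0].
have lS' c X Y : S' X -> S' Y -> S' (c *: X + Y).
  move=> [SX eX fX] [SY eY fY]; split; first exact: lS.
    by rewrite wr eX eY mulr0 addr0.
  by rewrite wr fX fY mulr0 addr0.
pose cons (v : nat -> V) k := match k with 0 => e | 1 => f | k.+2 => v k end.
case: (IH S' lS') => [[u hu]|[v hv Sv]].
  left; exists (cons u) => X SX uX Y SY.
  have eX : w e X = 0 by exact: (uX 0).
  have fX : w f X = 0 by exact: (uX 1).
  (* [Y] is projected to the [w]-orthogonal of [e] and [f]; [w X] does not see the correction, as
     [X] is orthogonal to both. *)
  have -> : w X Y = w X (- w e Y *: f + (w f Y *: e + Y)).
    by rewrite !wr (wC X f) (wC X e) eX fX oppr0 !mulr0 !add0r.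
  have XS' : S' X by [].
  apply: (hu X) => //.
    by move=> j jm; apply: (uX j.+2).
  split; first exact: (lS _ _ _ Sf (lS _ _ _ Se SY)).
    by rewrite !wr ww ef; ring.
  by rewrite !wr ww (wC f e) ef; ring.
right; exists (cons v); last by move=> [|[|k]] // ltk; have [] := Sv k ltk.
move=> [|[|a]] [|[|b]] lta ltb; rewrite /std_symplectic /= ?ww ?ef ?oppr0 //.
- by have [_ -> _] := Sv b ltb.
- by rewrite wC ef.
- by have [_ _ ->] := Sv b ltb.
- by have [_ eX _] := Sv a lta; rewrite wC eX oppr0; case: ifP.
- by have [_ _ fX] := Sv a lta; rewrite wC fX oppr0 negbK; case: ifP => // oa;
  rewrite (_ : (_ == _) = false) ?oppr0 //; apply: contraTF oa => /eqP[->].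
- by rewrite hv // /std_symplectic negbK !eqSS.
Qed.

Lemma rank_le_of_no_symplectic_family (w : V -> V -> R) m :
  alternating_bilinear w -> (forall v, ~ symplectic_family w m.+1 v) ->
  exists u : 'I_(m * 2) -> V,
    forall X, (forall j, w (u j) X = 0) -> forall Y, w X Y = 0.
Proof.
move=> aw nosym; have [//|[u hu]|[v /nosym]//] :=
  @darboux_dichotomy w m (fun=> True) aw.
exists u => X uX Y; apply: hu => // j jm; exact: (uX (Ordinal jm)).
Qed.

(** * Dimension count *)

Definition functional (l : V -> R) :=
  forall c X Y, l (c *: X + Y) = c * l X + l Y.

Lemma functional_sum n (l : V -> R) (mu : 'I_n -> R) (v : 'I_n -> V) :
  functional l -> l (\sum_j mu j *: v j) = \sum_j mu j * l (v j).
Proof.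
move=> ll; elim/big_rec2: _ => [|j y1 y2 _ <-]; last exact: ll.
by have := ll (-1) 0 0; rewrite scaler0 addr0 mulN1r addNr.
Qed.

(** By [skew_free] the matrix of the functionals on [v] has independent rows. When square it is
    invertible, so a combination of the [v j] solves [l1 = 0] and [l2 = l2 X]. *)
Lemma functional_split n (F : pform n) v r1 r2
    (l1 : 'I_r1 -> V -> R) (l2 : 'I_r2 -> V -> R) :
  skew F -> multilinear F -> F v != 0 ->
  (forall i, functional (l1 i)) -> (forall i, functional (l2 i)) ->
  (forall u, (forall i, l1 i u = 0) -> (forall i, l2 i u = 0) ->
     annihilated F u) ->
  (n <= r1 + r2)%N /\
  (n = (r1 + r2)%N -> forall X, exists X1,
     (forall i, l1 i X1 = 0) /\ (forall i, l2 i (X - X1) = 0)).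
Proof.
move=> skF lF Fv l1l l2l aF.
pose B1 := \matrix_(j < n, i < r1) l1 i (v j).
pose B2 := \matrix_(j < n, i < r2) l2 i (v j).
pose comb (mu : 'rV[R]_n) := \sum_j mu ord0 j *: v j.
have B1E mu i : l1 i (comb mu) = (mu *m B1) ord0 i.
  by rewrite functional_sum // mxE; apply: eq_bigr => j _; rewrite mxE.
have B2E mu i : l2 i (comb mu) = (mu *m B2) ord0 i.
  by rewrite functional_sum // mxE; apply: eq_bigr => j _; rewrite mxE.
have freeB : row_free (row_mx B1 B2).
  apply/inj_row_free => mu; rewrite mul_mx_row -row_mx0 => /eq_row_mx[mu1 mu2].
  apply/rowP => j; rewrite mxE.
  apply: (skew_free (v := v) (mu := fun j => mu ord0 j) skF lF Fv).
  by apply: aF => i; rewrite -/(comb mu) ?B1E ?B2E ?mu1 ?mu2 mxE.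
split; first by rewrite -(eqP freeB) rank_leq_col.
move=> nr X; have fullB : row_full (row_mx B1 B2).
  by rewrite /row_full (eqP freeB) {1}nr.
have [D DB] := row_fullP fullB; pose mu := row_mx 0 (\row_i l2 i X) *m D.
have : mu *m row_mx B1 B2 = row_mx 0 (\row_i l2 i X).
  by rewrite -mulmxA DB mulmx1.
rewrite mul_mx_row => /eq_row_mx[mu1 mu2]; exists (comb mu); split=> i.
  by rewrite B1E mu1 mxE.
rewrite -scaleN1r addrC l2l B2E mu2 mxE; ring.
Qed.

End Pointwise_forms.
Arguments pwedge_exp {R V p} F m _.

(** * Consequences of the splitting at a point *)

Section Pointwise_splitting.
Local Open Scope ring_scope.
Context {R : comPzRingType} {V : zmodType}.
Context (G : V -> V -> R) (w : bool -> V -> V -> R) (phi : V -> V).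
Context (K : bool -> V -> Prop).
Implicit Types (X Y U W : V).
Hypothesis GDl : forall X Y W, G (X + Y) W = G X W + G Y W.
Hypothesis wDl : forall b X Y W, w b (X + Y) W = w b X W + w b Y W.
Hypothesis wC : forall b X Y, w b X Y = - w b Y X.
Hypothesis phiB : forall X Y, phi (X - Y) = phi X - phi Y.
Hypothesis Gphi : forall X Y, G X (phi Y) = w true X Y + w false X Y.
Hypothesis Gphi_skew : forall X Y, G X (phi Y) = - G (phi X) Y.
Hypothesis Gphi_phi : forall X Y, G (phi X) (phi (phi Y)) = G X (phi Y).
Hypothesis wK : forall b X Y, K b X -> w b X Y = 0.
Hypothesis phiK : forall b X, K b X -> K b (phi X).
Hypothesis splitK : forall b X, exists X1, K b X1 /\ K (~~ b) (X - X1).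

Let GphiE b X Y : G X (phi Y) = w b X Y + w (~~ b) X Y.
Proof. by rewrite Gphi; case: b; rewrite // addrC. Qed.

Let w_G b X X1 Y : K b X1 -> K (~~ b) (X - X1) ->
  w b X Y = G (X - X1) (phi Y).
Proof.
move=> k1 k2; rewrite (GphiE b) (wK _ k2) addr0 -{1}(subrK X1 X).
by rewrite wDl (wK _ k1) addr0.
Qed.

(** [w_G] expresses [w b] by [G] and the [K (~~ b)] component, and [phi] respects components. *)
Lemma split_form_phi b X Y : w b (phi X) (phi Y) = w b X Y.
Proof.
have [X1 [k1 k2]] := splitK b X.
have := phiK k2; rewrite phiB => k2'.
by rewrite (w_G _ k1 k2) (w_G _ (phiK k1) k2') -phiB Gphi_phi.
Qed.

(* [U = - 2 phi (phi X1)] as far as [G] can tell, where [X1] is the component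
   of [X] in [K b]. *)
Lemma split_form_eq0 b X U :
  (forall W, G U W = w (~~ b) (phi X) W *+ 2) -> forall Y, w b U Y = 0.
Proof.
move=> UE Y; have [X1 [k1 k2]] := splitK b X.
have := phiK k2; rewrite phiB => k2'.
have k3 := phiK (phiK k1).
have GU W : G (U + phi (phi X1) + phi (phi X1)) W = 0.
  rewrite !GDl UE -[G (phi (phi X1)) W]opprK -Gphi_skew (GphiE b).
  rewrite (wK _ (phiK k1)) add0r -(subrK (phi X1) (phi X)) wDl (wK _ k2').
  by rewrite add0r mulr2n; ring.
have -> : w b U Y = w b (U + phi (phi X1) + phi (phi X1)) Y.
  by rewrite !wDl !(wK _ k3) !addr0.
(* Only the component of [Y] in [K (~~ b)] matters, and there [w b] is again given by [G] and
   [phi]. *)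
have [Y1 [l1 l2]] := splitK b Y.
have := GU (phi (Y - Y1)); rewrite (GphiE b) wC (wC (~~ b)) (wK _ l2).
rewrite oppr0 addr0 => e.
by rewrite wC -(subrK Y1 Y) wDl (wK _ l1) addr0.
Qed.

End Pointwise_splitting.

(** * Contact pairs on a manifold *)

Section Real_vector_space.
Local Open Scope ring_scope.
Context {R : realType} {n : nat} (M : manifold R n).
Local Notation C := (smooth M).

(** A copy of the vector fields with real scalars: tensors evaluated at a point are [R]-multilinear
    on it, which replaces the tangent space. *)
Definition rvfield := vfield M.
HB.instance Definition _ := GRing.Zmodule.on rvfield.

Definition rvfield_scale (c : R) (X : rvfield) : rvfield :=
  (c%:A : C) *: (X : vfield M).

Lemma rvfield_scaleA b c X :
  rvfield_scale b (rvfield_scale c X) = rvfield_scale (b * c) X.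
Proof. by rewrite /rvfield_scale scalerA -scalerAl mul1r scalerA. Qed.

Lemma rvfield_scale1 : left_id 1 rvfield_scale.
Proof. by move=> X; rewrite /rvfield_scale !scale1r. Qed.

Lemma rvfield_scaleDr : right_distributive rvfield_scale +%R.
Proof. by move=> c X Y; exact: scalerDr. Qed.

Lemma rvfield_scaleDl X : {morph rvfield_scale^~ X : b c / b + c}.
Proof. by move=> b c; rewrite /rvfield_scale scalerDl; exact: scalerDl. Qed.

HB.instance Definition _ := GRing.Zmodule_isLmodule.Build R rvfield
  rvfield_scaleA rvfield_scale1 rvfield_scaleDr rvfield_scaleDl.

Lemma smoothD (f h : C) x : (f + h) x = f x + h x. Proof. by []. Qed.
Lemma smoothN (f : C) x : (- f) x = - f x. Proof. by []. Qed.
Lemma smoothM (f h : C) x : (f * h) x = f x * h x. Proof. by []. Qed.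
Lemma smoothZ c (f : C) x : (c *: f) x = c * f x. Proof. by []. Qed.
Lemma smooth0 x : (0 : C) x = 0. Proof. by []. Qed.
Lemma smooth1 x : (1 : C) x = 1. Proof. by []. Qed.

Lemma smooth_sum I (r : seq I) (P : pred I) (F : I -> C) x :
  (\sum_(i <- r | P i) F i) x = \sum_(i <- r | P i) F i x.
Proof. exact: (big_morph (fun f : C => f x)). Qed.

Lemma smooth_sign (s : nat) x : ((-1) ^+ s : C) x = (-1) ^+ s.
Proof. by elim: s => // s IH; rewrite !exprS smoothM IH. Qed.

Definition form_at p (w : @Defs.form R n M p) (x : M) : @pform R rvfield p :=
  fun v => w v x.

Lemma wedge_at p q (w : @Defs.form R n M p) (z : @Defs.form R n M q) x :
  form_at (wedge w z) x = pwedge (form_at w x) (form_at z x).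
Proof.
apply/funext => v; rewrite /form_at /wedge /pwedge smoothZ smooth_sum.
by congr (_ * _); apply: eq_bigr => s _; rewrite smoothM smooth_sign.
Qed.

Lemma wedge_exp_at p (w : @Defs.form R n M p) m x :
  form_at (wedge_exp w m) x = pwedge_exp (form_at w x) m.
Proof.
elim: m => [|m IH]; last by rewrite /= wedge_at IH.
by [].
Qed.

End Real_vector_space.

Section Metric_contact_pair.
Local Open Scope ring_scope.
Context {R : realType} {n : nat} {M : manifold R n}.
Local Notation C := (smooth M).
Local Notation VF := (vfield M).
Context (g : riemannian_metric M) (nabla : VF -> VF -> VF).
Hypothesis lc : levi_civita g nabla.
Implicit Types (X Y W : VF) (f h : C) (x : M).

Lemma smooth_ext f h : (forall x, f x = h x) -> f = h.
Proof. by move=> fh; apply/val_inj/funext. Qed.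

Lemma smooth_two_inj f : f + f = 0 -> f = 0.
Proof.
move=> ff; apply: smooth_ext => x; have := congr1 (fun f : C => f x) ff.
by rewrite smoothD smooth0; lra.
Qed.

Lemma vfieldD X f h : X (f + h) = (X f : C) + X h.
Proof.
have /asboolP[Xl _] := vfield_funP X.
by have := Xl 1 f h; rewrite !scale1r.
Qed.

Lemma vfieldM X f h : X (f * h) = (X f : C) * h + f * (X h : C).
Proof. by have /asboolP[_ ->] := vfield_funP X. Qed.

Lemma metric_at_definite X x : g X X x = 0 -> vanishes_at X x.
Proof.
by move=> gX; apply: contrapT => /(@metric_pos _ _ _ g); rewrite gX ltxx.
Qed.

Lemma metric_definite X : g X X = 0 -> X = 0.
Proof.
move=> gX; apply/val_inj/funext => f; apply: smooth_ext => x.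
by apply: metric_at_definite; rewrite gX.
Qed.

Lemma metricDl X Y W : g (X + Y) W = g X W + g Y W.
Proof. by have := metric_linear g 1 X Y W; rewrite scale1r mul1r. Qed.

Lemma metric0l W : g 0 W = 0.
Proof. by apply: (addrI (g 0 W)); rewrite -metricDl !addr0. Qed.

Lemma metricZl f X W : g (f *: X) W = f * g X W.
Proof. by have := metric_linear g f X 0 W; rewrite metric0l !addr0. Qed.

Lemma metricNl X W : g (- X) W = - g X W.
Proof. by rewrite -scaleN1r metricZl mulN1r. Qed.

Lemma ext_dE (a : one_form M) Z : (forall X, g X Z = a X) ->
  forall X Y, ext_d a X Y = 2^-1 *: (g (nabla X Z) Y - g X (nabla Y Z)).
Proof.
move=> aE X Y; rewrite /ext_d -!aE -(levi_civita_torsion_free lc).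
rewrite !(levi_civita_metric lc) metricDl metricNl.
rewrite (Defs.metric_sym g Y (nabla X Z)); congr (_ *: _).
by move: (g _ Z) (g _ Z) (g _ Y) (g X _) => b c d e; ring.
Qed.

Lemma ext_d_alternating (a : one_form M) Z x : (forall X, g X Z = a X) ->
  alternating_bilinear (fun X Y : rvfield M => ext_d a X Y x).
Proof.
move=> aE; split=> [c X Y W|X Y]; rewrite !(ext_dE aE) !smoothZ.
  rewrite (connection_tensorial (levi_civita_connection lc)) !metric_linear.
  rewrite !(smoothD, smoothN, smoothM) smoothZ smooth1; ring.
rewrite !(smoothD, smoothN) (Defs.metric_sym g (nabla Y Z)).
by rewrite (Defs.metric_sym g Y); ring.
Qed.

(** Equations of the characteristic distribution at [x], once the [u j] cut out the kernel of [d a]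
    as in [char_eqsP]. *)
Definition char_eqs (a : one_form M) x r (u : 'I_r -> VF) (i : 'I_(1 + r))
    (X : rvfield M) : R :=
  match fintype.split i with inl _ => (a X : C) x | inr j => ext_d a (u j) X x end.

Lemma one_form_at_linear (a : one_form M) x :
  functional (fun X : rvfield M => (a X : C) x).
Proof.
move=> c X Y; rewrite linearP.
by rewrite smoothD smoothM smoothZ smooth1 mulr1.
Qed.

Lemma char_eqs_linear (a : one_form M) Z x r (u : 'I_r -> VF) i :
  (forall X, g X Z = a X) -> functional (char_eqs a x u i).
Proof.
move=> aE c X Y; rewrite /char_eqs; case: (fintype.split i) => [_|j].
  exact: one_form_at_linear.
exact: (alternating_linear_r c X Y (u j) (ext_d_alternating x aE)).
Qed.

Lemma char_eqsP (a : one_form M) x r (u : 'I_r -> VF) X :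
  (forall X, (forall j, ext_d a (u j) X x = 0) -> forall Y, ext_d a X Y x = 0) ->
  (forall i, char_eqs a x u i X = 0) -> in_char_foliation a x X.
Proof.
move=> kera eqs; split.
  by have := eqs (lshift r ord0); rewrite /char_eqs (unsplitK (inl _)).
apply: kera => j.
by have := eqs (rshift 1 j); rewrite /char_eqs (unsplitK (inr _)).
Qed.

(** A vector in both characteristic distributions annihilates every factor of the volume form, so
    [functional_split] applies to the two systems [char_eqs]. *)
Lemma contact_pair_split (a1 a2 : one_form M) Z1 Z2 (h k : nat) x r1 r2
    (u1 : 'I_r1 -> VF) (u2 : 'I_r2 -> VF) :
  (forall X, g X Z1 = a1 X) -> (forall X, g X Z2 = a2 X) ->
  contact_pair h k a1 a2 ->
  (forall X, (forall j, ext_d a1 (u1 j) X x = 0) -> forall Y, ext_d a1 X Y x = 0) ->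
  (forall X, (forall j, ext_d a2 (u2 j) X x = 0) -> forall Y, ext_d a2 X Y x = 0) ->
  (n <= (1 + r1) + (1 + r2))%N /\
  (n = ((1 + r1) + (1 + r2))%N -> forall X, exists X1,
    in_char_foliation a1 x X1 /\ in_char_foliation a2 x (X - X1)).
Proof.
move=> a1E a2E [[pn /(_ x)[v volv] _ _]] ker1 ker2.
have aw1 := ext_d_alternating x a1E; have aw2 := ext_d_alternating x a2E.
have m1 : multilinear (form_at (form_of2 (ext_d a1)) x).
  exact: (multilinear_pform2 aw1).
have m2 : multilinear (form_at (form_of2 (ext_d a2)) x).
  exact: (multilinear_pform2 aw2).
have l1 (a : one_form M) : multilinear (form_at (form_of1 a) x).
  move=> v' i c X Y; rewrite /form_at /form_of1 /subst_arg (ord1 i) eqxx.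
  exact: one_form_at_linear.
have ann1 (a : one_form M) u :
    (a u : C) x = 0 -> annihilated (form_at (form_of1 a) x) u.
  move=> au v' i vi; rewrite /form_at /form_of1.
  by rewrite (_ : v' ord0 = u) // -vi (ord1 i).
move: volv; set vol := wedge _ _ => volv.
have volE : form_at vol x = pwedge (pwedge (pwedge (form_at (form_of1 a1) x)
    (pwedge_exp (form_at (form_of2 (ext_d a1)) x) h)) (form_at (form_of1 a2) x))
    (pwedge_exp (form_at (form_of2 (ext_d a2)) x) k).
  by rewrite !(wedge_at, wedge_exp_at).
have [] := @functional_split _ (rvfield M) _ (form_at vol x) v _ _
  (char_eqs a1 x u1) (char_eqs a2 x u2).
- by rewrite volE; exact: pwedge_skew.
- rewrite volE; apply: multilinear_pwedge.
    apply: multilinear_pwedge => //; apply: multilinear_pwedge => //.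
    exact: multilinear_pwedge_exp.
  exact: multilinear_pwedge_exp.
- exact: volv.
- by move=> i; exact: (char_eqs_linear _ _ _ a1E).
- by move=> i; exact: (char_eqs_linear _ _ _ a2E).
- move=> u /(char_eqsP ker1)[c1 d1] /(char_eqsP ker2)[c2 d2].
  rewrite volE; apply: annihilated_pwedge.
    apply: annihilated_pwedge; last exact: ann1.
    apply: annihilated_pwedge; first exact: ann1.
    exact: (annihilated_pwedge_exp (annihilated_pform2 aw1 d1)).
  exact: (annihilated_pwedge_exp (annihilated_pform2 aw2 d2)).
rewrite pn => rk splt; split=> // nr X; have [X1 [e1 e2]] := splt nr X.
by exists X1; split; [exact: (char_eqsP ker1)|exact: (char_eqsP ker2)].
Qed.

(** A family of [h.+1] symplectic pairs would make the vanishing power of [d a] positive at [x]. *)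
Lemma rank_le_contact (a : one_form M) Z (h : nat) x :
  (forall X, g X Z = a X) ->
  (forall v, wedge_exp (form_of2 (ext_d a)) h.+1 v = 0) ->
  exists u : 'I_(h * 2) -> VF, forall X,
    (forall j, ext_d a (u j) X x = 0) -> forall Y, ext_d a X Y x = 0.
Proof.
move=> aE dah; have aw := ext_d_alternating x aE.
apply: (rank_le_of_no_symplectic_family aw) => v /symplectic_family_pwedge_exp.
have e := wedge_exp_at (form_of2 (ext_d a)) h.+1 x.
have : form_at (wedge_exp (form_of2 (ext_d a)) h.+1) x (fun i => v i) = 0.
  by rewrite /form_at dah.
by rewrite e => ->; rewrite ltxx.
Qed.

(** * The rank bound in the flat case *)

Context (a : bool -> one_form M) (Z : bool -> VF) (phi : tensor11 M).
Hypothesis aE : forall b X, g X (Z b) = a b X.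
Hypothesis aZ : forall b c, a b (Z c) = (b == c)%:R.
Hypothesis dZ : forall b c X, ext_d (a b) (Z c) X = 0.
Hypothesis phi2 : forall X, phi (phi X) =
  - X + (a true X : C) *: Z true + (a false X : C) *: Z false.
Hypothesis phiZ : forall b, phi (Z b) = 0.
Hypothesis gphi : forall X Y,
  g X (phi Y) = ext_d (a true) X Y + ext_d (a false) X Y.
Hypothesis phi_char : forall b x X,
  in_char_foliation (a b) x X -> in_char_foliation (a b) x (phi X).
Hypothesis char_split : forall b x X, exists X1,
  in_char_foliation (a b) x X1 /\ in_char_foliation (a (~~ b)) x (X - X1).
Hypothesis nabla_flat : forall X Y W, curvature nabla X Y W = 0.

Let w b x X Y := ext_d (a b) X Y x.
Let g_at x X Y := g X Y x.

Let wDl x b X Y W : w b x (X + Y) W = w b x X W + w b x Y W.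
Proof.
have [wl _] := ext_d_alternating x (aE b).
by have := wl 1 X Y W; rewrite scale1r mul1r.
Qed.

Let wC x b X Y : w b x X Y = - w b x Y X.
Proof. by have [_] := ext_d_alternating x (aE b); apply. Qed.

Let g_atDl x X Y W : g_at x (X + Y) W = g_at x X W + g_at x Y W.
Proof. by rewrite /g_at metricDl. Qed.

Let g_at_phi x X Y : g_at x X (phi Y) = w true x X Y + w false x X Y.
Proof. by rewrite /g_at gphi. Qed.

Let gphi_skew X Y : g X (phi Y) = - g (phi X) Y.
Proof.
apply: smooth_ext => x; rewrite smoothN (Defs.metric_sym g (phi X)).
by rewrite -!/(g_at _ _ _) !g_at_phi (wC x true X) (wC x false X) opprD.
Qed.

Let gphi_phi X Y : g (phi X) (phi (phi Y)) = g X (phi Y).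
Proof.
rewrite gphi_skew phi2 !metricDl metricNl !metricZl -[g (Z _) _]opprK.
have gZphi b : g (Z b) (phi Y) = 0 by rewrite gphi_skew phiZ metric0l oppr0.
by rewrite opprK !gZphi !mulr0 !addr0 opprK.
Qed.

Let wK x b X Y : in_char_foliation (a b) x X -> w b x X Y = 0.
Proof. by case=> _ h; exact: h. Qed.

Lemma ext_d_phi b X Y : ext_d (a b) (phi X) (phi Y) = ext_d (a b) X Y.
Proof.
apply: smooth_ext => x.
apply: (split_form_phi (G := g_at x) (w := fun b => w b x)
  (K := fun b => in_char_foliation (a b) x)) => //.
- by move=> X' Y'; exact: linearB.
- by move=> X' Y'; rewrite /g_at gphi_phi.
- by move=> b' X' Y'; exact: wK.
- by move=> b' X'; exact: phi_char.
Qed.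

Lemma ext_d_split b X U :
  (forall W, g U W = ext_d (a (~~ b)) (phi X) W *+ 2) ->
  forall Y, ext_d (a b) U Y = 0.
Proof.
move=> UE Y; apply: smooth_ext => x.
apply: (@split_form_eq0 _ _ (g_at x) (fun b => w b x) phi
  (fun b => in_char_foliation (a b) x) _ _ _ _ _ _ _ _ _ b X U) => //.
- by move=> X' Y'; exact: linearB.
- by move=> X' Y'; rewrite /g_at gphi_skew.
- by move=> b' X' Y'; exact: wK.
- by move=> b' X'; exact: phi_char.
- by move=> W; rewrite /g_at UE mulr2n smoothD -mulr2n.
Qed.

Lemma reeb_derivative_minor b X Y V W :
  g V (nabla X (Z b)) * g W (nabla Y (Z b)) =
  g V (nabla Y (Z b)) * g W (nabla X (Z b)).
Proof.
have lcc := levi_civita_connection lc.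
have tE b' X' Y' : dform g nabla Z b' X' Y' = ext_d (a b') X' Y' *+ 2.
  rewrite (ext_dE (aE b')) scalerMnl -mulr_natr mulVf ?pnatr_eq0 //.
  by rewrite scale1r.
apply: (@shape_minor _ _ (metric_fun g) (fun X f => X f) nabla Z phi).
- exact: smooth_two_inj.
- exact: vfieldD.
- exact: vfieldM.
- exact: Defs.metric_sym.
- exact: metric_linear.
- exact: metric_definite.
- exact: (connection_tensorial lcc).
- exact: (connection_additive lcc).
- exact: (connection_leibniz lcc).
- exact: (levi_civita_metric lc).
- move=> X' Y' W'; rewrite (levi_civita_torsion_free lc).
  exact: nabla_flat.
- by move=> b1 b2; rewrite aE aZ eq_sym.
- by move=> b1 b2 X'; rewrite tE dZ mul0rn.
- by move=> X' Y'; rewrite gphi mulrnDl !tE.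
- by move=> X'; rewrite !aE phi2.
- exact: phiZ.
- by move=> b' X' Y'; rewrite !tE ext_d_phi.
move=> b' X' U gU Y'; rewrite tE (@ext_d_split b' X') ?mul0rn // => W'.
by rewrite gU tE.
Qed.

(** Up to a factor, [d a] is the skew part of a matrix [B] with vanishing minors, so its Pfaffian on
    four vectors is zero; on two symplectic pairs it is not. *)
Lemma no_symplectic_family2 b x v :
  ~ symplectic_family (fun X Y : rvfield M => ext_d (a b) X Y x) 2 v.
Proof.
move=> sv; pose B i j := g (v i) (nabla (v j) (Z b)) x.
have minor i j k l : B i j * B k l = B i l * B k j.
  by rewrite /B -!smoothM reeb_derivative_minor.
have wB i j : (i < 4)%N -> (j < 4)%N ->
    B j i - B i j = (std_symplectic i j : R) * 2.
  move=> i4 j4; rewrite -(sv i j) // (ext_dE (aE b)) smoothZ mulrAC mulVf //.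
  by rewrite mul1r /B (Defs.metric_sym g (v j)).
clearbody B.
(* Four times the Pfaffian, as a combination of six minors. *)
have pluecker : (B 1 0 - B 0 1) * (B 3 2 - B 2 3) -
    (B 2 0 - B 0 2) * (B 3 1 - B 1 3) + (B 3 0 - B 0 3) * (B 2 1 - B 1 2) = 0.
  apply: (eq_of_lincomb (lincombD (minor 1 0 3 2) (lincombN (lincombD
    (minor 1 0 2 3) (lincombD (minor 0 1 3 2) (lincombD (lincombN
    (minor 0 1 2 3)) (lincombD (minor 2 0 3 1) (minor 0 2 1 3)))))))).
  by ring.
move: pluecker; rewrite !wB // /std_symplectic /= !(mul0r, mulr0, subr0, addr0).
rewrite !mul1r => /eqP; rewrite mulf_eq0 orbb.
by rewrite pnatr_eq0.
Qed.

Lemma flat_rank_le2 b x : exists u : 'I_(1 * 2) -> VF, forall X,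
  (forall j, ext_d (a b) (u j) X x = 0) -> forall Y, ext_d (a b) X Y x = 0.
Proof.
apply: (rank_le_of_no_symplectic_family (ext_d_alternating x (aE b))).
exact: no_symplectic_family2.
Qed.

End Metric_contact_pair.

Theorem corollary5p3 (R : realType) (h k : nat)
    (M : manifold R (2 * h + 2 * k + 2)) (a1 a2 : one_form M)
    (phi : tensor11 M) (g : riemannian_metric M) :
  (1 <= h)%N ->
  metric_contact_pair h k a1 a2 phi g ->
  decomposable a1 a2 phi ->
  flat g ->
  (h <= 1)%N /\ (k <= 1)%N.
Proof.
move=> _ [Z1 [Z2 [[cp [[a11 a12] [a21 a22] d1 d2] phi2 phiZ1 phiZ2] [gphi gZ]]]].
move=> dec [nabla lc fl].
pose a b := if b then a1 else a2; pose Z b := if b then Z1 else Z2.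
have aE b X : g X (Z b) = a b X by case: b; case: (gZ X).
have [vol da1 da2] := cp.
(* The case of equality in [contact_pair_split], which yields the splitting. *)
have dim : (2 * h + 2 * k + 2 = (1 + h * 2) + (1 + k * 2))%N by lia.
have char_split b x X : exists X1,
    in_char_foliation (a b) x X1 /\ in_char_foliation (a (~~ b)) x (X - X1)%R.
  have [u1 ker1] := rank_le_contact lc x (aE true) da1.
  have [u2 ker2] := rank_le_contact lc x (aE false) da2.
  have [_ /(_ dim X)[X1 [c1 c2]]] :=
    contact_pair_split lc (aE true) (aE false) cp ker1 ker2.
  case: b; first by exists X1.
  by exists (X - X1)%R; split=> //; rewrite opprB addrCA subrr addr0.
have rank2 := @flat_rank_le2 _ _ _ g nabla lc a Z phi aE.
have {}rank2 : forall b x, exists u : 'I_(1 * 2) -> vfield M, forall X,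
  (forall j, ext_d (a b) (u j) X x = 0%R) ->
  forall Y, ext_d (a b) X Y x = 0%R.
  apply: rank2 => //.
  - by case=> [] [].
  - by case=> [] [] X; case: (d1 X); case: (d2 X).
  - by case.
  - by move=> b x X; case: b; have [] := dec x X.
have [x _] := manifold_nonempty M.
have [u1 ker1] := rank_le_contact lc x (aE true) da1.
have [u2 ker2] := rank_le_contact lc x (aE false) da2.
have [v1 ker1'] := rank2 true x; have [v2 ker2'] := rank2 false x.
(* With one rank bound lowered to two, [2 h + 2 k + 2 <= 3 + (1 + 2 k)] gives [h <= 1]; likewise for
   [k]. *)
have [le1 _] := contact_pair_split lc (aE true) (aE false) cp ker1' ker2.
have [le2 _] := contact_pair_split lc (aE true) (aE false) cp ker1 ker2'.
by split; lia.
Qed.
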